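(* Let $k\in\mathbb{N}$ and $\phi\in\mathrm{Diff}_1(\mathbb{R})$. (i) If $\phi(x)\le x+\frac{s}{4k}$ for all $x\in\mathbb{R}$ for some $s\in(0,1)$, then for every positive path $\{\phi^t\}_{t\in[0,1]}$ from $\mathrm{id}$ to $\phi$ generated by a time-dependent Hamiltonian in $\mathcal{P}_k$, $$\mathrm{length}_V(\{\phi^t\}_{t\in[0,1]})\le\frac{1}{1-s}\int_0^1(\phi(x)-x)\,\mathrm{d}x.$$ (ii) If $\phi(x)>x+\frac1k$ for all $x\in\mathbb{R}$, then there exists $\psi\in\mathrm{Diff}_1(\mathbb{R})$ with $\mathrm{id}<\psi<\phi$ and positive paths from $\mathrm{id}$ to $\psi$ generated by time-dependent Hamiltonians in $\mathcal{P}_k$ with arbitrarily large $\mathrm{length}_V$.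
   Context: $\mathrm{Diff}_1(\mathbb{R})$ is the group of diffeomorphisms $\phi:\mathbb{R}\to\mathbb{R}$ with $\phi(x+1)=\phi(x)+1$ for all $x$; it is ordered by pointwise comparison of functions ($\psi<\phi$ means $\psi(x)<\phi(x)$ for all $x$). A positive path generated by a smooth function $H:[0,1]\times\mathbb{R}\to(0,\infty)$, 1-periodic in $x$, is the solution of $\frac{\mathrm{d}}{\mathrm{d}t}\phi^t=H(t,\phi^t)$, $\phi^0=\mathrm{id}$; it goes from $\mathrm{id}$ to $\phi^1$. Its length is $\mathrm{length}_V(\{\phi^t\}_{t\in[0,1]})=\int_0^1\left(\int_0^1\frac{\mathrm{d}x}{H(t,x)}\right)^{-1}\mathrm{d}t$. $\mathcal{P}_k$ is the space of smooth functions on $[0,1]\times\mathbb{R}$ of the form $p(t,x)=\sum_{j=0}^k(a_j(t)\cos(2\pi jx)+b_j(t)\sin(2\pi jx))$ with smooth $a_j,b_j$. *)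

(* Defs.v *)
From Stdlib Require Import Reals.
From Coquelicot Require Import Coquelicot.
Open Scope R_scope.

Definition smooth (f : R -> R) : Prop :=
  forall (n : nat) (x : R), ex_derive (Derive_n f n) x.

Definition Diff1 (phi : R -> R) : Prop :=
  smooth phi /\
  (exists g : R -> R, smooth g /\ (forall x, g (phi x) = x) /\ (forall x, phi (g x) = x)) /\
  (forall x, phi (x + 1) = phi x + 1).

Definition ham (k : nat) (a b : nat -> R -> R) (t x : R) : R :=
  sum_f_R0 (fun j => a j t * cos (2 * PI * INR j * x) + b j t * sin (2 * PI * INR j * x)) k.

Definition coeffs_smooth (k : nat) (a b : nat -> R -> R) : Prop :=
  forall j, (j <= k)%nat -> smooth (a j) /\ smooth (b j).

Definition positive_ham (H : R -> R -> R) : Prop :=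
  forall t x, 0 <= t <= 1 -> 0 < H t x.

Definition generates (H : R -> R -> R) (Phi : R -> R -> R) : Prop :=
  (forall x, Phi 0 x = x) /\
  (forall x t, 0 <= t <= 1 -> is_derive (fun s => Phi s x) t (H t (Phi t x))).

Definition lengthV (H : R -> R -> R) : R :=
  RInt (fun t => / RInt (fun x => / H t x) 0 1) 0 1.

Definition Pk_positive_path (k : nat) (a b : nat -> R -> R) (Phi : R -> R -> R)
  (psi : R -> R) : Prop :=
  coeffs_smooth k a b /\ positive_ham (ham k a b) /\ generates (ham k a b) Phi /\
  (forall x, Phi 1 x = psi x).

(* Main.v *)
Require Import Defs.
From Stdlib Require Import Reals Lra Lia ZArith.
From Coquelicot Require Import Coquelicot.
Open Scope R_scope.

(** (i) By Jensen, the length is at most the integral of the mean [a 0] of the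
    Hamiltonian.  M. Riesz' interpolation formula writes the derivative of a
    trigonometric polynomial of degree [k] as a combination of [2 k] of its
    translates, whose negative weights have total mass [PI * k]; as a
    point is displaced by at most [s / (4 k)], replacing [H t x] by
    [H t (Phi t x)] costs in the mean over [x] at most the fraction
    [PI * s / 4 <= s] of the mean.

    (ii) Hamiltonians with the single frequency [k] generate the universal cover
    of PSL(2,R), on which the length is the Lorentzian length of anti-de Sitter
    space.  A timelike curve from the identity to the rotation by [PI * (1 + del)]
    (which translates by [(1 + del) / k]) can come close to the boundary at
    infinity and come back, so that its length is unbounded. *)

(** In (i) the Hamiltonian must be averaged at the moving points [Phi t x]. To avoid a change of
    variables by [Phi t] and an exchange of integrals, [H t (Phi t x)] is bounded below, at fixed
    [x], by an expression at [x] that is linear in the coefficients of [H t]. Its integral over time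
    is the same expression for the integrated coefficients, and the mean over [x] is taken last, by
    explicit antiderivatives. Positivity of [H] allows the positive Riesz weights to be dropped. The
    absolute weights add up to [k] and the signed ones to 0, as constants have derivative 0; so the
    negative ones weigh [k / 2], and the period 1 contributes the factor [2 * PI].

    In (ii) the endpoint must not depend on the length. The excursion may be arbitrarily high
    because its conformal height stays below [PI / 2]; the surplus [PI * del] of turning keeps the
    curve uniformly timelike while the length density grows with the height. *)

(** * Smoothness with explicit derivatives *)

Fixpoint diffn (n : nat) (f : R -> R) : Prop :=
  match n with
  | O => True
  | S m => exists f', (forall x, is_derive f x (f' x)) /\ diffn m f'
  end.

Lemma diffn_S (n : nat) (f : R -> R) : diffn (S n) f -> diffn n f.
Proof.
  revert f; induction n as [|n IH]; intros f Hf; [exact I|].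
  destruct Hf as [f' [Hd Hf']]; exists f'; split; [exact Hd|now apply IH].
Qed.

Lemma diffn_ext (n : nat) (f g : R -> R) :
  (forall x, f x = g x) -> diffn n f -> diffn n g.
Proof.
  destruct n as [|n]; intros E Hf; [exact I|].
  destruct Hf as [f' [Hd Hf']]; exists f'; split; [|exact Hf'].
  intros x; now apply is_derive_ext with f.
Qed.

(** [diffn] takes its derivatives as witnesses, so that closure under the operations below is a
    plain induction on the order; this lemma is the only passage back to [Derive_n]. *)
Lemma diffn_smooth (f : R -> R) : (forall n, diffn n f) -> smooth f.
Proof.
  intros Hf n; specialize (Hf (S n)); revert f Hf.
  induction n as [|n IH]; intros f [f' [Hd Hf']] x.
  - exists (f' x); apply Hd.
  - apply ex_derive_ext with (Derive_n f' n); [|now apply IH].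
    intros t; replace (S n) with (n + 1)%nat by lia.
    rewrite <- (Derive_n_comp f n 1); apply Derive_n_ext; intros u; simpl.
    symmetry; apply is_derive_unique, Hd.
Qed.

Lemma diffn_const (n : nat) (c : R) : diffn n (fun _ => c).
Proof.
  revert c; induction n as [|n IH]; intros c; [exact I|].
  exists (fun _ => 0); split; [|apply IH]. intros x; auto_derive; auto.
Qed.

Lemma diffn_id (n : nat) : diffn n (fun x => x).
Proof.
  destruct n as [|n]; [exact I|].
  exists (fun _ => 1); split; [|apply diffn_const]. intros x; auto_derive; auto.
Qed.

Lemma diffn_plus (n : nat) (f g : R -> R) :
  diffn n f -> diffn n g -> diffn n (fun x => f x + g x).
Proof.
  revert f g; induction n as [|n IH]; intros f g; [easy|].
  intros [f' [Hf Hf']] [g' [Hg Hg']].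
  exists (fun x => f' x + g' x); split; [|now apply IH].
  intros x; apply (is_derive_plus (K := R_AbsRing) (V := R_NormedModule) f g); auto.
Qed.

Lemma diffn_mult (n : nat) (f g : R -> R) :
  diffn n f -> diffn n g -> diffn n (fun x => f x * g x).
Proof.
  revert f g; induction n as [|n IH]; intros f g; [easy|]; intros Hf0 Hg0.
  pose proof (diffn_S _ _ Hf0) as Hf1; pose proof (diffn_S _ _ Hg0) as Hg1.
  destruct Hf0 as [f' [Hf Hf']]; destruct Hg0 as [g' [Hg Hg']].
  exists (fun x => f' x * g x + f x * g' x); split.
  - intros x; apply (is_derive_mult f g); auto; intros; apply Rmult_comm.
  - apply diffn_plus; now apply IH.
Qed.

Lemma diffn_opp (n : nat) (f : R -> R) : diffn n f -> diffn n (fun x => - f x).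
Proof.
  intros Hf; apply diffn_ext with (fun x => -1 * f x); [intros; ring|].
  apply diffn_mult; [apply diffn_const|exact Hf].
Qed.

(** The derivative is a product of [f'] and the reciprocal itself, to which the induction hypothesis
    applies one order lower. The square root is treated the same way. *)
Lemma diffn_inv (n : nat) (f : R -> R) :
  (forall x, f x <> 0) -> diffn n f -> diffn n (fun x => / f x).
Proof.
  intros Hnz; induction n as [|n IH]; [easy|]; intros Hf0.
  pose proof (IH (diffn_S _ _ Hf0)) as Hi.
  destruct Hf0 as [f' [Hf Hf']].
  exists (fun x => - f' x * (/ f x * / f x)); split.
  - intros x; replace (- f' x * (/ f x * / f x)) with (- f' x / (f x) ^ 2)
      by (field; apply Hnz).
    now apply is_derive_inv.
  - apply diffn_mult; [now apply diffn_opp|now apply diffn_mult].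
Qed.

Lemma diffn_sqrt (n : nat) (f : R -> R) :
  (forall x, 0 < f x) -> diffn n f -> diffn n (fun x => sqrt (f x)).
Proof.
  intros Hpos; induction n as [|n IH]; [easy|]; intros Hf0.
  pose proof (IH (diffn_S _ _ Hf0)) as Hi.
  destruct Hf0 as [f' [Hf Hf']].
  exists (fun x => f' x * (/ 2 * / sqrt (f x))); split.
  - intros x; replace (f' x * (/ 2 * / sqrt (f x))) with (f' x / (2 * sqrt (f x)))
      by (field; apply Rgt_not_eq, sqrt_lt_R0, Hpos).
    apply (is_derive_sqrt f x (f' x)); auto.
  - apply diffn_mult; [exact Hf'|apply diffn_mult; [apply diffn_const|]].
    apply diffn_inv; [|exact Hi].
    intros x; apply Rgt_not_eq, sqrt_lt_R0, Hpos.
Qed.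

Lemma diffn_cos_sin (n : nat) (f : R -> R) :
  diffn n f -> diffn n (fun x => cos (f x)) /\ diffn n (fun x => sin (f x)).
Proof.
  induction n as [|n IH]; [easy|]; intros Hf0.
  destruct (IH (diffn_S _ _ Hf0)) as [Hc Hs].
  destruct Hf0 as [f' [Hf Hf']].
  split.
  - exists (fun x => f' x * - sin (f x)); split.
    + intros x; apply (is_derive_comp cos f); [apply is_derive_cos|apply Hf].
    + apply diffn_mult; [exact Hf'|now apply diffn_opp].
  - exists (fun x => f' x * cos (f x)); split.
    + intros x; apply (is_derive_comp sin f); [apply is_derive_sin|apply Hf].
    + now apply diffn_mult.
Qed.

(** * Finite sums *)

Lemma is_derive_sum_f_R0 (f : nat -> R -> R) (d : nat -> R) (n : nat) (x : R) :
  (forall j, (j <= n)%nat -> is_derive (f j) x (d j)) ->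
  is_derive (fun y => sum_f_R0 (fun j => f j y) n) x (sum_f_R0 d n).
Proof.
  induction n as [|n IH]; intros H; simpl; [now apply H|].
  apply (is_derive_plus (K := R_AbsRing) (V := R_NormedModule)
           (fun y => sum_f_R0 (fun j => f j y) n) (f (S n))).
  - apply IH; intros; apply H; lia.
  - apply H; lia.
Qed.

Lemma sum_f_R0_exchange (u : nat -> nat -> R) (m n : nat) :
  sum_f_R0 (fun i => sum_f_R0 (u i) n) m =
  sum_f_R0 (fun j => sum_f_R0 (fun i => u i j) m) n.
Proof.
  induction m as [|m IH]; simpl.
  - apply sum_eq; reflexivity.
  - rewrite IH, <- plus_sum; apply sum_eq; reflexivity.
Qed.

Lemma sum_f_R0_nonneg (u : nat -> R) (n : nat) :
  (forall i, (i <= n)%nat -> 0 <= u i) -> 0 <= sum_f_R0 u n.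
Proof.
  intros H; induction n as [|n IH]; simpl; [now apply H|].
  apply Rplus_le_le_0_compat; [apply IH; intros; apply H; lia|apply H; lia].
Qed.

Lemma sum_f_R0_telescope (G : nat -> R) (n : nat) :
  sum_f_R0 (fun r => G (S r) - G r) n = G (S n) - G 0%nat.
Proof. induction n as [|n IH]; simpl; [ring|rewrite IH; simpl; ring]. Qed.

Lemma sin_INR_2PI (j : nat) : sin (2 * PI * INR j) = 0.
Proof.
  replace (2 * PI * INR j) with (0 + 2 * INR j * PI) by ring.
  rewrite sin_period; apply sin_0.
Qed.

Lemma cos_INR_2PI (j : nat) : cos (2 * PI * INR j) = 1.
Proof.
  replace (2 * PI * INR j) with (0 + 2 * INR j * PI) by ring.
  rewrite cos_period; apply cos_0.
Qed.

Lemma arithmetic_progression (u : nat -> R) (n : nat) :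
  (forall j, (S j < n)%nat -> 2 * u (S j) - u (S (S j)) - u j = 0) ->
  forall j, (j < n)%nat -> u (S j) = u j + (u 1%nat - u 0%nat).
Proof.
  intros H; induction j as [|j IH]; intros Hj; [ring|].
  pose proof (H j Hj); rewrite (IH ltac:(lia)) in *; lra.
Qed.

Lemma arithmetic_progression_closed (u : nat -> R) (n : nat) :
  (forall j, (S j < n)%nat -> 2 * u (S j) - u (S (S j)) - u j = 0) ->
  forall j, (j <= n)%nat -> u j = u 0%nat + INR j * (u 1%nat - u 0%nat).
Proof.
  intros H; induction j as [|j IH]; intros Hj; [simpl; ring|].
  rewrite (arithmetic_progression u n H j Hj), S_INR, IH by lia; ring.
Qed.

(** * M. Riesz' interpolation formula *)

(** For [r < 2 * n] these are the zeros of [cos (n * z)] in the interval from 0 to [2 * PI]; there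
    [sin (n * z)] alternates between 1 and -1. *)
Definition node (n r : nat) : R := (2 * INR r + 1) * PI / (2 * INR n).

Definition riesz_weight (n r : nat) : R := / (4 * INR n * (sin (node n r / 2)) ^ 2).

Section Riesz.

Variable n : nat.
Hypothesis n_pos : (0 < n)%nat.

Let INR_n_pos : 0 < INR n.
Proof. now apply lt_0_INR. Qed.

Lemma n_mult_node (r : nat) : INR n * node n r = INR r * PI + PI / 2.
Proof. unfold node; field; lra. Qed.

Lemma cos_n_node (r : nat) : cos (INR n * node n r) = 0.
Proof.
  rewrite n_mult_node; induction r as [|r IH].
  - simpl; rewrite Rmult_0_l, Rplus_0_l; apply cos_PI2.
  - rewrite S_INR; replace ((INR r + 1) * PI + PI / 2) with (INR r * PI + PI / 2 + PI) by ring.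
    rewrite neg_cos, IH; ring.
Qed.

Lemma sin_n_node (r : nat) : sin (INR n * node n r) = (-1) ^ r.
Proof.
  rewrite n_mult_node; induction r as [|r IH].
  - simpl; rewrite Rmult_0_l, Rplus_0_l; apply sin_PI2.
  - rewrite S_INR; replace ((INR r + 1) * PI + PI / 2) with (INR r * PI + PI / 2 + PI) by ring.
    rewrite neg_sin, IH; simpl; ring.
Qed.

Lemma sin_half_node_pos (r : nat) : (r <= 2 * n - 1)%nat -> 0 < sin (node n r / 2).
Proof.
  intros Hr.
  assert (H : 0 < (2 * INR r + 1) / (4 * INR n) < 1).
  { pose proof (pos_INR r).
    assert (Hr' : 2 * INR r + 1 < 4 * INR n).
    { replace 4 with (INR 4) by (simpl; ring). replace 2 with (INR 2) by (simpl; ring).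
      rewrite <- !mult_INR, <- S_INR; apply lt_INR; lia. }
    split; [apply Rdiv_lt_0_compat; lra|].
    apply Rmult_lt_reg_r with (4 * INR n); [lra|].
    unfold Rdiv; rewrite Rmult_assoc, Rinv_l; lra. }
  pose proof PI_RGT_0.
  replace (node n r / 2) with ((2 * INR r + 1) / (4 * INR n) * PI) by (unfold node; field; lra).
  apply sin_gt_0; nra.
Qed.

Lemma riesz_weight_pos (r : nat) : (r <= 2 * n - 1)%nat -> 0 < riesz_weight n r.
Proof.
  intros Hr; pose proof (sin_half_node_pos r Hr).
  apply Rinv_0_lt_compat, Rmult_lt_0_compat; [lra|now apply pow_lt].
Qed.

Let cos_step_pos (j : nat) : (j < n)%nat -> 0 < cos (INR j * (PI / (2 * INR n))).
Proof.
  intros Hj; apply lt_INR in Hj; pose proof (pos_INR j); pose proof PI_RGT_0.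
  assert (Hq : 0 <= INR j / INR n < 1).
  { split; [apply Rmult_le_pos; [lra|left; now apply Rinv_0_lt_compat]|].
    apply Rmult_lt_reg_r with (INR n); [lra|].
    unfold Rdiv; rewrite Rmult_assoc, Rinv_l; lra. }
  replace (INR j * (PI / (2 * INR n))) with (INR j / INR n * (PI / 2)) by (field; lra).
  apply cos_gt_0; nra.
Qed.

(** The nodes are the odd multiples of [d], so multiplication by [- 2 * cos (j * d)] turns the sum
    into a telescoping one whose ends differ by whole turns. Below frequency [n] this factor is
    nonzero by [cos_step_pos]. *)
Lemma alternating_sum_sin (j : nat) : (j < n)%nat ->
  sum_f_R0 (fun r => (-1) ^ r * sin (INR j * node n r)) (2 * n - 1) = 0.
Proof.
  intros Hj; pose proof (cos_step_pos j Hj) as Hc; set (d := PI / (2 * INR n)) in *.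
  apply Rmult_eq_reg_l with (-(2 * cos (INR j * d))); [|lra].
  rewrite Rmult_0_r, scal_sum.
  pose (G := fun r => (-1) ^ r * sin (2 * INR j * INR r * d)).
  rewrite sum_eq with (Bn := fun r => G (S r) - G r).
  - rewrite sum_f_R0_telescope; unfold G.
    replace (S (2 * n - 1)) with (2 * n)%nat by lia.
    rewrite pow_1_even, mult_INR.
    replace (2 * INR j * (INR 2 * INR n) * d) with (2 * PI * INR j)
      by (unfold d; simpl; field; lra).
    replace (2 * INR j * INR 0 * d) with 0 by (simpl; ring).
    rewrite sin_INR_2PI, sin_0; ring.
  - intros r _; unfold G; rewrite S_INR.
    replace (2 * INR j * (INR r + 1) * d) with (INR j * node n r + INR j * d)
      by (unfold node, d; field; lra).
    replace (2 * INR j * INR r * d) with (INR j * node n r - INR j * d)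
      by (unfold node, d; field; lra).
    rewrite sin_plus, sin_minus; simpl; ring.
Qed.

Lemma alternating_sum_cos (j : nat) : (j < n)%nat ->
  sum_f_R0 (fun r => (-1) ^ r * cos (INR j * node n r)) (2 * n - 1) = 0.
Proof.
  intros Hj; pose proof (cos_step_pos j Hj) as Hc; set (d := PI / (2 * INR n)) in *.
  apply Rmult_eq_reg_l with (-(2 * cos (INR j * d))); [|lra].
  rewrite Rmult_0_r, scal_sum.
  pose (G := fun r => (-1) ^ r * cos (2 * INR j * INR r * d)).
  rewrite sum_eq with (Bn := fun r => G (S r) - G r).
  - rewrite sum_f_R0_telescope; unfold G.
    replace (S (2 * n - 1)) with (2 * n)%nat by lia.
    rewrite pow_1_even, mult_INR.
    replace (2 * INR j * (INR 2 * INR n) * d) with (2 * PI * INR j)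
      by (unfold d; simpl; field; lra).
    replace (2 * INR j * INR 0 * d) with 0 by (simpl; ring).
    rewrite cos_INR_2PI, cos_0; simpl; ring.
  - intros r _; unfold G; rewrite S_INR.
    replace (2 * INR j * (INR r + 1) * d) with (INR j * node n r + INR j * d)
      by (unfold node, d; field; lra).
    replace (2 * INR j * INR r * d) with (INR j * node n r - INR j * d)
      by (unfold node, d; field; lra).
    rewrite cos_plus, cos_minus; simpl; ring.
Qed.

Let signed (r : nat) : R := (-1) ^ r * riesz_weight n r.

(** Since [2 - 2 * cos z = 4 * sin (z / 2) ^ 2], a second difference in the frequency cancels the
    denominator of the weight. *)
Let signed_second_difference (r : nat) : (r <= 2 * n - 1)%nat ->
  signed r * (2 - 2 * cos (node n r)) = (-1) ^ r / INR n.
Proof.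
  intros Hr; pose proof (sin_half_node_pos r Hr).
  replace (node n r) with (2 * (node n r / 2)) by field.
  rewrite cos_2a_sin; unfold signed, riesz_weight.
  replace (2 * (node n r / 2) / 2) with (node n r / 2) by field.
  field; lra.
Qed.

Definition sine_moment (j : nat) : R :=
  sum_f_R0 (fun r => (-1) ^ r * riesz_weight n r * sin (INR j * node n r)) (2 * n - 1).

Definition cosine_moment (j : nat) : R :=
  sum_f_R0 (fun r => (-1) ^ r * riesz_weight n r * cos (INR j * node n r)) (2 * n - 1).

(* The weights are chosen so that their second differences in frequency are
   the alternating sums, which vanish below frequency [n]. *)
Lemma sine_moment_second_difference (j : nat) :
  2 * sine_moment (S j) - sine_moment (S (S j)) - sine_moment j =
  / INR n * sum_f_R0 (fun r => (-1) ^ r * sin (INR (S j) * node n r)) (2 * n - 1).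
Proof.
  unfold sine_moment; rewrite !scal_sum, <- !minus_sum; apply sum_eq; intros r Hr.
  replace (INR (S (S j)) * node n r) with (INR (S j) * node n r + node n r)
    by (rewrite (S_INR (S j)); ring).
  replace (INR j * node n r) with (INR (S j) * node n r - node n r)
    by (rewrite (S_INR j); ring).
  rewrite sin_plus, sin_minus.
  transitivity (signed r * (2 - 2 * cos (node n r)) * sin (INR (S j) * node n r));
    [unfold signed; ring|].
  rewrite signed_second_difference by exact Hr; field; lra.
Qed.

Lemma cosine_moment_second_difference (j : nat) :
  2 * cosine_moment (S j) - cosine_moment (S (S j)) - cosine_moment j =
  / INR n * sum_f_R0 (fun r => (-1) ^ r * cos (INR (S j) * node n r)) (2 * n - 1).
Proof.
  unfold cosine_moment; rewrite !scal_sum, <- !minus_sum; apply sum_eq; intros r Hr.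
  replace (INR (S (S j)) * node n r) with (INR (S j) * node n r + node n r)
    by (rewrite (S_INR (S j)); ring).
  replace (INR j * node n r) with (INR (S j) * node n r - node n r)
    by (rewrite (S_INR j); ring).
  rewrite cos_plus, cos_minus.
  transitivity (signed r * (2 - 2 * cos (node n r)) * cos (INR (S j) * node n r));
    [unfold signed; ring|].
  rewrite signed_second_difference by exact Hr; field; lra.
Qed.

(** The moments are affine in [j] up to [n]. The slope vanishes because they are even in [j], and
    the value at [n] vanishes because the nodes are zeros of [cos (n * z)]. *)
Lemma cosine_moment_eq (j : nat) : (j <= n)%nat -> cosine_moment j = 0.
Proof.
  assert (Hlin := arithmetic_progression_closed cosine_moment n).
  (* This is the second difference at frequency 0, halved: by evenness the neighbours at -1 and 1
     agree. *)
  assert (H01 : cosine_moment 1 = cosine_moment 0).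
  { apply Rminus_diag_uniq_sym.
    transitivity (/ 2 * (/ INR n *
      sum_f_R0 (fun r => (-1) ^ r * cos (INR 0 * node n r)) (2 * n - 1))).
    - unfold cosine_moment; rewrite !scal_sum, <- !minus_sum; apply sum_eq; intros r Hr.
      simpl INR; rewrite Rmult_0_l, cos_0, Rmult_1_l.
      transitivity (/ 2 * (signed r * (2 - 2 * cos (node n r)))); [unfold signed; field|].
      rewrite signed_second_difference by exact Hr; field; lra.
    - rewrite alternating_sum_cos by exact n_pos; ring. }
  assert (Hn : cosine_moment n = 0).
  { unfold cosine_moment; rewrite sum_eq with (Bn := fun _ => 0); [apply sum_eq_R0; auto|].
    intros r _; rewrite cos_n_node; ring. }
  assert (Hl : forall j, (j <= n)%nat -> cosine_moment j = cosine_moment 0).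
  { intros i Hi; rewrite Hlin; [rewrite H01; ring| |exact Hi].
    intros m Hm; rewrite cosine_moment_second_difference, alternating_sum_cos by exact Hm; ring. }
  intros Hj; rewrite (Hl j Hj), <- (Hl n (le_n n)); exact Hn.
Qed.

(** Again the moments are affine up to [n], now starting at 0. The slope is found at the upper end,
    where the second difference does not vanish. *)
Lemma sine_moment_eq (j : nat) : (j <= n)%nat -> sine_moment j = INR j.
Proof.
  assert (Hrec : forall j, (S j < n)%nat ->
    2 * sine_moment (S j) - sine_moment (S (S j)) - sine_moment j = 0).
  { intros m Hm; rewrite sine_moment_second_difference, alternating_sum_sin by exact Hm; ring. }
  assert (H0 : sine_moment 0 = 0).
  { unfold sine_moment; rewrite sum_eq with (Bn := fun _ => 0); [apply sum_eq_R0; auto|].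
    intros r _; simpl INR; rewrite Rmult_0_l, sin_0; ring. }
  assert (H1 : sine_moment 1 = 1).
  { destruct (Nat.lt_exists_pred 0 n n_pos) as [m [Em _]].
    (* Here [n = S m]. As [cos (n * z)] vanishes at the nodes, the moments at [n + 1] and [n - 1]
       agree, so the second difference at [n] is twice the slope; by [Htop] it equals 2. *)
    assert (Hsym : sine_moment (S (S m)) = sine_moment m).
    { unfold sine_moment; apply sum_eq; intros r _.
      replace (INR (S (S m)) * node n r) with (INR n * node n r + node n r)
        by (rewrite (S_INR (S m)), <- Em; ring).
      replace (INR m * node n r) with (INR n * node n r - node n r)
        by (rewrite Em, (S_INR m); ring).
      rewrite sin_plus, sin_minus, cos_n_node; ring. }
    assert (Htop : sum_f_R0 (fun r => (-1) ^ r * sin (INR (S m) * node n r)) (2 * n - 1)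
                   = 2 * INR n).
    { rewrite <- Em, sum_eq with (Bn := fun _ => 1).
      - rewrite sum_cte; replace (S (2 * n - 1)) with (2 * n)%nat by lia.
        rewrite mult_INR; simpl; ring.
      - intros r _; rewrite sin_n_node, <- Rpow_mult_distr.
        replace (-1 * -1) with 1 by ring; apply pow1. }
    pose proof (sine_moment_second_difference m) as H.
    rewrite Hsym, Htop, (arithmetic_progression sine_moment n Hrec m ltac:(lia)), H0 in H.
    replace (/ INR n * (2 * INR n)) with 2 in H by (field; lra). lra. }
  intros Hj; rewrite (arithmetic_progression_closed sine_moment n Hrec j Hj), H0, H1; ring.
Qed.

(** At frequency [n] the sine at a node is its own sign, so the sine moment there is the unsigned
    sum. *)
Lemma sum_riesz_weight : sum_f_R0 (riesz_weight n) (2 * n - 1) = INR n.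
Proof.
  rewrite <- (sine_moment_eq n (le_n n)); apply sum_eq; intros r _.
  rewrite sin_n_node; replace ((-1) ^ r * riesz_weight n r * (-1) ^ r)
    with (((-1) * (-1)) ^ r * riesz_weight n r) by (rewrite Rpow_mult_distr; ring).
  replace (-1 * -1) with 1 by ring; rewrite pow1; ring.
Qed.

Lemma sum_signed_riesz_weight :
  sum_f_R0 (fun r => (-1) ^ r * riesz_weight n r) (2 * n - 1) = 0.
Proof.
  rewrite <- (cosine_moment_eq 0 (Nat.le_0_l n)); apply sum_eq; intros r _.
  simpl INR; rewrite Rmult_0_l, cos_0; ring.
Qed.

End Riesz.

Lemma nonneg_derive_le (f df : R -> R) (u v : R) : u <= v ->
  (forall x, u <= x <= v -> is_derive f x (df x)) ->
  (forall x, u <= x <= v -> 0 <= df x) -> f u <= f v.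
Proof.
  intros Huv Hd Hn.
  destruct (MVT_gen f u v df) as [c [Hc E]].
  - rewrite Rmin_left, Rmax_right by lra; intros x Hx; apply Hd; lra.
  - rewrite Rmin_left, Rmax_right by lra; intros x Hx.
    apply continuity_pt_filterlim, (ex_derive_continuous (K := R_AbsRing) (V := R_NormedModule) f).
    exists (df x); now apply Hd.
  - rewrite Rmin_left, Rmax_right in Hc by lra.
    pose proof (Hn c Hc); nra.
Qed.

Lemma is_derive_shift (f : R -> R) (d x l : R) :
  is_derive f (x + d) l -> is_derive (fun y => f (y + d)) x l.
Proof.
  intros H; rewrite <- (Rmult_1_l l).
  apply (is_derive_comp f (fun y => y + d)); [exact H|auto_derive; auto].
Qed.

(** * Trigonometric polynomials and their antiderivatives *)

Definition lincomb (k : nat) (A B : nat -> R) (f g : nat -> R -> R) (x : R) : R :=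
  sum_f_R0 (fun j => A j * f j x + B j * g j x) k.

Definition cosine (j : nat) (x : R) : R := cos (2 * PI * INR j * x).
Definition sine (j : nat) (x : R) : R := sin (2 * PI * INR j * x).

(** First and second antiderivatives. Frequency 0 is separate because its antiderivatives are
    polynomials; they are the only non-periodic terms, so increments over a period see only the mean
    [A 0]. The second level serves to integrate [correction], which is built from the first. *)
Definition cosine1 (j : nat) (x : R) : R :=
  match j with O => x | S _ => / (2 * PI * INR j) * sine j x end.
Definition sine1 (j : nat) (x : R) : R :=
  match j with O => 0 | S _ => - / (2 * PI * INR j) * cosine j x end.

Definition cosine2 (j : nat) (x : R) : R :=
  match j with O => x ^ 2 / 2 | S _ => - (/ (2 * PI * INR j)) ^ 2 * cosine j x end.
Definition sine2 (j : nat) (x : R) : R :=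
  match j with O => 0 | S _ => - (/ (2 * PI * INR j)) ^ 2 * sine j x end.

Definition trig (k : nat) (A B : nat -> R) : R -> R := lincomb k A B cosine sine.
Definition trig1 (k : nat) (A B : nat -> R) : R -> R := lincomb k A B cosine1 sine1.
Definition trig2 (k : nat) (A B : nat -> R) : R -> R := lincomb k A B cosine2 sine2.

Lemma is_derive_cosine (j : nat) (x : R) :
  is_derive (cosine j) x (- (2 * PI * INR j) * sine j x).
Proof. unfold cosine, sine; auto_derive; auto; ring. Qed.

Lemma is_derive_sine (j : nat) (x : R) :
  is_derive (sine j) x (2 * PI * INR j * cosine j x).
Proof. unfold cosine, sine; auto_derive; auto; ring. Qed.

Lemma frequency_neq_0 (j : nat) : 2 * PI * INR (S j) <> 0.
Proof.
  pose proof PI_RGT_0; pose proof (lt_0_INR (S j) ltac:(lia)); nra.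
Qed.

Lemma is_derive_cosine1 (j : nat) (x : R) : is_derive (cosine1 j) x (cosine j x).
Proof.
  destruct j as [|j]; unfold cosine1.
  - unfold cosine; simpl INR; rewrite Rmult_0_r, Rmult_0_l, cos_0; auto_derive; auto.
  - replace (cosine (S j) x) with
      (/ (2 * PI * INR (S j)) * (2 * PI * INR (S j) * cosine (S j) x))
      by (field; pose proof (frequency_neq_0 j); split; [|apply PI_neq0]; nra).
    apply (is_derive_scal (sine (S j))), is_derive_sine.
Qed.

Lemma is_derive_sine1 (j : nat) (x : R) : is_derive (sine1 j) x (sine j x).
Proof.
  destruct j as [|j]; unfold sine1.
  - unfold sine; simpl INR; rewrite Rmult_0_r, Rmult_0_l, sin_0; auto_derive; auto.
  - replace (sine (S j) x) with
      (- / (2 * PI * INR (S j)) * (- (2 * PI * INR (S j)) * sine (S j) x))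
      by (field; pose proof (frequency_neq_0 j); split; [|apply PI_neq0]; nra).
    apply (is_derive_scal (cosine (S j))), is_derive_cosine.
Qed.

Lemma is_derive_cosine2 (j : nat) (x : R) : is_derive (cosine2 j) x (cosine1 j x).
Proof.
  destruct j as [|j]; unfold cosine2, cosine1.
  - auto_derive; auto; field.
  - replace (/ (2 * PI * INR (S j)) * sine (S j) x) with
      (- (/ (2 * PI * INR (S j))) ^ 2 * (- (2 * PI * INR (S j)) * sine (S j) x))
      by (field; pose proof (frequency_neq_0 j); split; [|apply PI_neq0]; nra).
    apply (is_derive_scal (cosine (S j))), is_derive_cosine.
Qed.

Lemma is_derive_sine2 (j : nat) (x : R) : is_derive (sine2 j) x (sine1 j x).
Proof.
  destruct j as [|j]; unfold sine2, sine1.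
  - auto_derive; auto.
  - replace (- / (2 * PI * INR (S j)) * cosine (S j) x) with
      (- (/ (2 * PI * INR (S j))) ^ 2 * (2 * PI * INR (S j) * cosine (S j) x))
      by (field; pose proof (frequency_neq_0 j); split; [|apply PI_neq0]; nra).
    apply (is_derive_scal (sine (S j))), is_derive_sine.
Qed.

Lemma is_derive_lincomb (k : nat) (A B : nat -> R) (f g f' g' : nat -> R -> R) (x : R) :
  (forall j, is_derive (f j) x (f' j x)) -> (forall j, is_derive (g j) x (g' j x)) ->
  is_derive (lincomb k A B f g) x (lincomb k A B f' g' x).
Proof.
  intros Hf Hg; unfold lincomb.
  apply (is_derive_sum_f_R0 (fun j y => A j * f j y + B j * g j y)).
  intros j _.
  apply (is_derive_plus (K := R_AbsRing) (V := R_NormedModule)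
           (fun y => A j * f j y) (fun y => B j * g j y)); now apply is_derive_scal.
Qed.

Lemma is_derive_trig1 (k : nat) (A B : nat -> R) (x : R) :
  is_derive (trig1 k A B) x (trig k A B x).
Proof. apply is_derive_lincomb; intros; [apply is_derive_cosine1|apply is_derive_sine1]. Qed.

Lemma is_derive_trig2 (k : nat) (A B : nat -> R) (x : R) :
  is_derive (trig2 k A B) x (trig1 k A B x).
Proof. apply is_derive_lincomb; intros; [apply is_derive_cosine2|apply is_derive_sine2]. Qed.

Lemma ex_derive_trig (k : nat) (A B : nat -> R) (x : R) : ex_derive (trig k A B) x.
Proof.
  eexists; apply (is_derive_lincomb k A B cosine sine
    (fun j y => - (2 * PI * INR j) * sine j y) (fun j y => 2 * PI * INR j * cosine j y));
    intros; [apply is_derive_cosine|apply is_derive_sine].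
Qed.

Lemma continuous_trig (k : nat) (A B : nat -> R) (x : R) : continuous (trig k A B) x.
Proof.
  apply (ex_derive_continuous (K := R_AbsRing) (V := R_NormedModule)), ex_derive_trig.
Qed.

Lemma is_derive_lincomb_coeffs (k : nat) (A B : nat -> R -> R) (A' B' : nat -> R)
    (f g : nat -> R -> R) (t x : R) :
  (forall j, (j <= k)%nat -> is_derive (A j) t (A' j)) ->
  (forall j, (j <= k)%nat -> is_derive (B j) t (B' j)) ->
  is_derive (fun s => lincomb k (fun j => A j s) (fun j => B j s) f g x) t
    (lincomb k A' B' f g x).
Proof.
  intros HA HB; unfold lincomb.
  apply (is_derive_sum_f_R0 (fun j s => A j s * f j x + B j s * g j x)).
  intros j Hj.
  apply (is_derive_plus (K := R_AbsRing) (V := R_NormedModule)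
           (fun s => A j s * f j x) (fun s => B j s * g j x)).
  - replace (A' j * f j x) with (f j x * A' j) by ring.
    apply is_derive_ext with (fun s => f j x * A j s); [intros; apply Rmult_comm|].
    apply is_derive_scal; auto.
  - replace (B' j * g j x) with (g j x * B' j) by ring.
    apply is_derive_ext with (fun s => g j x * B j s); [intros; apply Rmult_comm|].
    apply is_derive_scal; auto.
Qed.

Lemma cosine_period (j : nat) (x : R) : cosine j (x + 1) = cosine j x.
Proof.
  unfold cosine; replace (2 * PI * INR j * (x + 1)) with (2 * PI * INR j * x + 2 * INR j * PI)
    by ring; apply cos_period.
Qed.

Lemma sine_period (j : nat) (x : R) : sine j (x + 1) = sine j x.
Proof.
  unfold sine; replace (2 * PI * INR j * (x + 1)) with (2 * PI * INR j * x + 2 * INR j * PI)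
    by ring; apply sin_period.
Qed.

Lemma lincomb_increment_period (k : nat) (A B : nat -> R) (f g : nat -> R -> R) (x : R) :
  (forall j, f (S j) (x + 1) = f (S j) x) -> (forall j, g j (x + 1) = g j x) ->
  lincomb k A B f g (x + 1) - lincomb k A B f g x = A 0%nat * (f 0%nat (x + 1) - f 0%nat x).
Proof.
  intros Hf Hg; unfold lincomb; induction k as [|k IH]; simpl.
  - rewrite Hg; ring.
  - rewrite Hf, Hg; rewrite <- IH; ring.
Qed.

Lemma trig1_increment_period (k : nat) (A B : nat -> R) (x : R) :
  trig1 k A B (x + 1) - trig1 k A B x = A 0%nat.
Proof.
  unfold trig1; rewrite lincomb_increment_period; [simpl; ring| |].
  - intros j; unfold cosine1; now rewrite sine_period.
  - intros [|j]; unfold sine1; [reflexivity|now rewrite cosine_period].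
Qed.

Lemma trig2_increment_period (k : nat) (A B : nat -> R) (x : R) :
  trig2 k A B (x + 1) - trig2 k A B x = A 0%nat * (x + 1 / 2).
Proof.
  unfold trig2; rewrite lincomb_increment_period; [simpl; field| |].
  - intros j; unfold cosine2; now rewrite cosine_period.
  - intros [|j]; unfold sine2; [reflexivity|now rewrite sine_period].
Qed.

(** * Riesz' formula with period 1 and the cost of a displacement *)

Definition shift (k r : nat) : R := node k r / (2 * PI).

(** By the addition formulas the weighted translates multiply the frequency [j] part by the cosine
    moment 0 and its quarter-period translate by the sine moment [j], which is what differentiation
    does up to the factor [2 * PI]. *)
Lemma is_derive_trig_riesz (k : nat) (A B : nat -> R) (x : R) : (0 < k)%nat ->
  is_derive (trig k A B) x
    (2 * PI * sum_f_R0 (fun r => (-1) ^ r * riesz_weight k r * trig k A B (x + shift k r))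
                       (2 * k - 1)).
Proof.
  intros Hk.
  replace (2 * PI * sum_f_R0 _ _) with
    (lincomb k A B (fun j y => - (2 * PI * INR j) * sine j y)
       (fun j y => 2 * PI * INR j * cosine j y) x).
  { apply is_derive_lincomb; intros; [apply is_derive_cosine|apply is_derive_sine]. }
  pose proof PI_RGT_0 as Hpi.
  rewrite sum_eq with (Bn := fun r => sum_f_R0 (fun j =>
    ((A j * cosine j x + B j * sine j x) *
       ((-1) ^ r * riesz_weight k r * cos (INR j * node k r)) +
     (- A j * sine j x + B j * cosine j x) *
       ((-1) ^ r * riesz_weight k r * sin (INR j * node k r)))) k).
  - rewrite sum_f_R0_exchange, scal_sum; unfold lincomb; apply sum_eq; intros j Hj.
    rewrite plus_sum.
    assert (E : forall (c : R) (u : nat -> R) m,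
      sum_f_R0 (fun r => c * u r) m = c * sum_f_R0 u m).
    { intros c u m; rewrite scal_sum; apply sum_eq; intros; ring. }
    rewrite !E; fold (cosine_moment k j); fold (sine_moment k j).
    rewrite cosine_moment_eq, sine_moment_eq by assumption; ring.
  - intros r _; unfold trig, lincomb; rewrite scal_sum; apply sum_eq; intros j _.
    unfold cosine, sine.
    replace (2 * PI * INR j * (x + shift k r)) with (2 * PI * INR j * x + INR j * node k r)
      by (unfold shift; field; lra).
    rewrite cos_plus, sin_plus; ring.
Qed.

Definition neg_weight (k r : nat) : R := (1 - (-1) ^ r) / 2 * riesz_weight k r.

Lemma pow_m1_cases (r : nat) : (-1) ^ r = 1 \/ (-1) ^ r = -1.
Proof. induction r as [|r [IH|IH]]; simpl; [left|right|left]; lra. Qed.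

Lemma neg_weight_nonneg (k r : nat) : (0 < k)%nat -> (r <= 2 * k - 1)%nat ->
  0 <= neg_weight k r.
Proof.
  intros Hk Hr; pose proof (riesz_weight_pos k Hk r Hr); unfold neg_weight.
  destruct (pow_m1_cases r) as [-> | ->]; lra.
Qed.

(** The negative part is half the difference between the absolute and the signed sum, which are [k]
    and 0. *)
Lemma sum_neg_weight (k : nat) : (0 < k)%nat ->
  sum_f_R0 (neg_weight k) (2 * k - 1) = INR k / 2.
Proof.
  intros Hk.
  replace (INR k / 2) with (/ 2 * (sum_f_R0 (riesz_weight k) (2 * k - 1) -
    sum_f_R0 (fun r => (-1) ^ r * riesz_weight k r) (2 * k - 1)))
    by (rewrite sum_riesz_weight, sum_signed_riesz_weight by exact Hk; field).
  rewrite <- minus_sum, scal_sum; apply sum_eq; intros; unfold neg_weight; field.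
Qed.

(** With [F] an antiderivative of a nonnegative trigonometric polynomial, this bounds its possible
    decrease between [x] and [x + c]. Increments of [F] stand for integrals, which makes linearity
    in the coefficients evident. *)
Definition correction (k : nat) (F : R -> R) (c x : R) : R :=
  2 * PI * sum_f_R0 (fun r => neg_weight k r * (F (x + (c + shift k r)) - F (x + shift k r)))
                    (2 * k - 1).

(* Riesz' formula bounds the derivative from below by its negative weights,
   whose total mass is [PI * k]. *)
Lemma trig_lower_bound (k : nat) (A B : nat -> R) (c x u : R) : (0 < k)%nat ->
  (forall y, 0 <= trig k A B y) -> x <= u <= x + c ->
  trig k A B x - correction k (trig1 k A B) c x <= trig k A B u.
Proof.
  intros Hk Hpos Hu; pose proof PI_RGT_0.
  (* Adding the antiderivative of the negative Riesz terms leaves only nonnegative terms in the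
     derivative, so [G] is nondecreasing. *)
  set (G := fun y => trig k A B y +
    2 * PI * sum_f_R0 (fun r => neg_weight k r * trig1 k A B (y + shift k r)) (2 * k - 1)).
  assert (HG : G x <= G u).
  { apply nonneg_derive_le with (df := fun y =>
      2 * PI * sum_f_R0 (fun r => (-1) ^ r * riesz_weight k r * trig k A B (y + shift k r))
                       (2 * k - 1) +
      2 * PI * sum_f_R0 (fun r => neg_weight k r * trig k A B (y + shift k r)) (2 * k - 1)).
    - lra.
    - intros y _; unfold G.
      apply (is_derive_plus (K := R_AbsRing) (V := R_NormedModule) (trig k A B)
        (fun y => 2 * PI *
           sum_f_R0 (fun r => neg_weight k r * trig1 k A B (y + shift k r)) (2 * k - 1))).
      + now apply is_derive_trig_riesz.
      + apply is_derive_scal.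
        apply (is_derive_sum_f_R0 (fun r y => neg_weight k r * trig1 k A B (y + shift k r))).
        intros r _; apply is_derive_scal.
        apply (is_derive_shift (trig1 k A B)), is_derive_trig1.
    - intros y _; rewrite <- Rmult_plus_distr_l, <- plus_sum.
      apply Rmult_le_pos; [lra|]; apply sum_f_R0_nonneg; intros r Hr.
      pose proof (riesz_weight_pos k Hk r Hr); pose proof (Hpos (y + shift k r)).
      rewrite <- Rmult_plus_distr_r; apply Rmult_le_pos; [|assumption].
      unfold neg_weight; destruct (pow_m1_cases r) as [-> | ->]; lra. }
  (* The antiderivatives are nondecreasing, so [u] may be pushed to [x + c]; the bound no longer
     depends on the moving point. *)
  assert (HS : 2 * PI * sum_f_R0 (fun r => neg_weight k r * trig1 k A B (u + shift k r)) (2 * k - 1)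
    <= 2 * PI * sum_f_R0 (fun r => neg_weight k r * trig1 k A B (x + (c + shift k r))) (2 * k - 1)).
  { apply Rmult_le_compat_l; [lra|]; apply sum_Rle; intros r Hr.
    apply Rmult_le_compat_l; [now apply neg_weight_nonneg|].
    apply nonneg_derive_le with (trig k A B); [lra| |auto].
    intros; apply is_derive_trig1. }
  unfold correction.
  rewrite sum_eq with (Bn := fun r => neg_weight k r * trig1 k A B (x + (c + shift k r)) -
    neg_weight k r * trig1 k A B (x + shift k r)) by (intros; ring).
  rewrite minus_sum; unfold G in HG; lra.
Qed.

Lemma is_derive_correction (k : nat) (F F' : R -> R) (c x : R) :
  (forall y, is_derive F y (F' y)) ->
  is_derive (correction k F c) x (correction k F' c x).
Proof.
  intros H; unfold correction; apply is_derive_scal.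
  apply (is_derive_sum_f_R0 (fun r y => neg_weight k r * (F (y + (c + shift k r)) - F (y + shift k r)))).
  intros r _; apply is_derive_scal.
  apply (is_derive_minus (K := R_AbsRing) (V := R_NormedModule)
    (fun y => F (y + (c + shift k r))) (fun y => F (y + shift k r)));
    apply (is_derive_shift F), H.
Qed.

Lemma is_derive_correction_coeffs (k : nat) (F : R -> R -> R) (F' : R -> R) (c t x : R) :
  (forall y, is_derive (fun s => F s y) t (F' y)) ->
  is_derive (fun s => correction k (F s) c x) t (correction k F' c x).
Proof.
  intros H; unfold correction; apply is_derive_scal.
  apply (is_derive_sum_f_R0 (fun r s => neg_weight k r * (F s (x + (c + shift k r)) - F s (x + shift k r)))).
  intros r _; apply is_derive_scal.
  apply (is_derive_minus (K := R_AbsRing) (V := R_NormedModule)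
    (fun s => F s (x + (c + shift k r))) (fun s => F s (x + shift k r))); apply H.
Qed.

(** Over a period, [trig2] at [x + (c + shift k r)] gains [c * A 0] more than at [x + shift k r],
    whatever [r] is; so only the total [k / 2] of the negative weights enters. *)
Lemma is_RInt_trig_minus_correction (k : nat) (A B : nat -> R) (c : R) : (0 < k)%nat ->
  is_RInt (fun x => trig k A B x - correction k (trig1 k A B) c x) 0 1
    ((1 - PI * INR k * c) * A 0%nat).
Proof.
  intros Hk.
  set (W := fun x => trig1 k A B x - correction k (trig2 k A B) c x).
  replace ((1 - PI * INR k * c) * A 0%nat) with (minus (W 1) (W 0)).
  - apply (is_RInt_derive W).
    + intros x _; apply (is_derive_minus (K := R_AbsRing) (V := R_NormedModule)
        (trig1 k A B) (correction k (trig2 k A B) c)); [apply is_derive_trig1|].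
      apply is_derive_correction, is_derive_trig2.
    + intros x _; apply (continuous_minus (U := R_UniformSpace) (K := R_AbsRing) (V := R_NormedModule)
        (trig k A B) (correction k (trig1 k A B) c)); [apply continuous_trig|].
      apply (ex_derive_continuous (K := R_AbsRing) (V := R_NormedModule)).
      eexists; apply is_derive_correction, is_derive_trig1.
  - unfold minus, plus, opp; simpl; unfold W.
    assert (HC : correction k (trig2 k A B) c 1 - correction k (trig2 k A B) c 0 =
                 PI * INR k * c * A 0%nat).
    { unfold correction; rewrite <- Rmult_minus_distr_l, <- minus_sum.
      rewrite sum_eq with (Bn := fun r => neg_weight k r * (c * A 0%nat)).
      - rewrite <- scal_sum, sum_neg_weight by exact Hk; field.
      - intros r _.
        pose proof (trig2_increment_period k A B (c + shift k r)) as E1.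
        pose proof (trig2_increment_period k A B (shift k r)) as E2.
        rewrite !Rplus_0_l, !(Rplus_comm 1), <- Rmult_minus_distr_l.
        f_equal; lra. }
    pose proof (trig1_increment_period k A B 0) as E; rewrite Rplus_0_l in E; lra.
Qed.

(** * Displacement along a positive path *)

Lemma smooth_continuous (f : R -> R) (x : R) : smooth f -> continuous f x.
Proof.
  intros H; apply (ex_derive_continuous (K := R_AbsRing) (V := R_NormedModule)), (H 0%nat).
Qed.

Lemma coeffs_continuous (k : nat) (a b : nat -> R -> R) (j : nat) (t : R) :
  coeffs_smooth k a b -> (j <= k)%nat -> continuous (a j) t /\ continuous (b j) t.
Proof. intros H Hj; destruct (H j Hj); split; now apply smooth_continuous. Qed.

Lemma is_derive_RInt_continuous (f : R -> R) (t : R) :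
  (forall x, continuous f x) -> is_derive (RInt f 0) t (f t).
Proof.
  intros H; apply is_derive_RInt with 0; [|apply H].
  apply filter_forall; intros y.
  apply RInt_correct, (ex_RInt_continuous (V := R_CompleteNormedModule)); auto.
Qed.

Section Path.

Variables (k : nat) (a b : nat -> R -> R) (Phi : R -> R -> R) (phi : R -> R).
Hypothesis path : Pk_positive_path k a b Phi phi.

Lemma path_nondecreasing (x t : R) : 0 <= t <= 1 -> x <= Phi t x <= phi x.
Proof.
  destruct path as [_ [Hpos [[H0 Hd] H1]]]; intros Ht.
  assert (Hm : forall u v, 0 <= u -> u <= v -> v <= 1 -> Phi u x <= Phi v x).
  { intros u v Hu Huv Hv.
    apply (nonneg_derive_le (fun s => Phi s x) (fun s => ham k a b s (Phi s x))); [exact Huv| |].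
    - intros s Hs; apply Hd; lra.
    - intros s Hs; left; apply Hpos; lra. }
  rewrite <- H1; split; [rewrite <- (H0 x) at 1|]; apply Hm; lra.
Qed.

(** At a fixed point the time integral of the Hamiltonian is the trigonometric polynomial with these
    integrated coefficients, called [trigbar] below. *)
Let abar (j : nat) (t : R) : R := RInt (a j) 0 t.
Let bbar (j : nat) (t : R) : R := RInt (b j) 0 t.

Let abar_derive (j : nat) (t : R) : (j <= k)%nat -> is_derive (abar j) t (a j t).
Proof.
  intros Hj; apply is_derive_RInt_continuous; intros x.
  apply (coeffs_continuous k a b j x (proj1 path) Hj).
Qed.

Let bbar_derive (j : nat) (t : R) : (j <= k)%nat -> is_derive (bbar j) t (b j t).
Proof.
  intros Hj; apply is_derive_RInt_continuous; intros x.
  apply (coeffs_continuous k a b j x (proj1 path) Hj).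
Qed.

Let trigbar (t : R) : R -> R := trig k (fun j => abar j t) (fun j => bbar j t).
Let trigbar1 (t : R) : R -> R := trig1 k (fun j => abar j t) (fun j => bbar j t).

Let lincomb_zero (f g : nat -> R -> R) (x : R) :
  lincomb k (fun j => abar j 0) (fun j => bbar j 0) f g x = 0.
Proof.
  unfold lincomb; apply sum_eq_R0; intros j _; unfold abar, bbar.
  rewrite !RInt_point; unfold zero; simpl; ring.
Qed.

(** Positivity of the Hamiltonian confines [Phi t x] to the interval from [x] to [x + c], where
    [trig_lower_bound] applies at each time; [F] integrates this bound over time. *)
Lemma displacement_lower_bound (c x : R) : (0 < k)%nat -> phi x <= x + c ->
  trigbar 1 x - correction k (trigbar1 1) c x <= phi x - x.
Proof.
  intros Hk Hc; destruct path as [Hs [Hpos [[H0 Hd] H1]]].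
  pose (F := fun t => Phi t x - (trigbar t x - correction k (trigbar1 t) c x)).
  assert (HF : F 0 <= F 1).
  { apply nonneg_derive_le with (fun t => ham k a b t (Phi t x) -
      (trig k (fun j => a j t) (fun j => b j t) x -
       correction k (trig1 k (fun j => a j t) (fun j => b j t)) c x)).
    - lra.
    - intros t Ht.
      apply (is_derive_minus (K := R_AbsRing) (V := R_NormedModule) (fun t => Phi t x)); [now apply Hd|].
      apply (is_derive_minus (K := R_AbsRing) (V := R_NormedModule) (fun t => trigbar t x)).
      + apply (is_derive_lincomb_coeffs k abar bbar); auto.
      + apply (is_derive_correction_coeffs k trigbar1); intros y.
        apply (is_derive_lincomb_coeffs k abar bbar); auto.
    - intros t Ht.
      pose proof (path_nondecreasing x t Ht).
      assert (Hl := trig_lower_bound k (fun j => a j t) (fun j => b j t) c x (Phi t x) Hk).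
      change (ham k a b t (Phi t x)) with (trig k (fun j => a j t) (fun j => b j t) (Phi t x)).
      rewrite <- Rminus_le_0; apply Hl; [intros y; left; now apply Hpos|lra]. }
  unfold F in HF; rewrite H0, H1 in HF.
  assert (E1 : trigbar 0 x = 0) by apply lincomb_zero.
  assert (E2 : correction k (trigbar1 0) c x = 0).
  { unfold correction; rewrite sum_eq with (Bn := fun _ => 0).
    - rewrite sum_eq_R0 by auto; ring.
    - intros r _; unfold trigbar1, trig1; rewrite !lincomb_zero; ring. }
  lra.
Qed.

(** There are no nodes in degree 0, but then the Hamiltonian does not depend on [x]. *)
Lemma displacement_degree_0 (x : R) : k = 0%nat -> RInt (a 0%nat) 0 1 <= phi x - x.
Proof.
  intros Hk; destruct path as [Hs [Hpos [[H0 Hd] H1]]].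
  pose (F := fun t => Phi t x - abar 0%nat t).
  assert (HF : F 0 <= F 1).
  { apply nonneg_derive_le with (fun t => ham k a b t (Phi t x) - a 0%nat t).
    - lra.
    - intros t Ht.
      apply (is_derive_minus (K := R_AbsRing) (V := R_NormedModule) (fun t => Phi t x)); [now apply Hd|].
      apply abar_derive; lia.
    - intros t Ht; rewrite Hk; unfold ham; simpl.
      rewrite !Rmult_0_r, !Rmult_0_l, cos_0, sin_0; lra. }
  unfold F in HF; rewrite H0, H1 in HF.
  assert (E : abar 0%nat 0 = 0) by (unfold abar; rewrite RInt_point; reflexivity).
  unfold abar in *; lra.
Qed.

(** The factor [INR k] in the bound on the displacement lets degree 0 in: the bound is then void and
    the factor on the left of the conclusion is 1. *)
Lemma volume_lower_bound (c : R) : (forall x, continuous phi x) ->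
  (forall x, INR k * (phi x - x) <= INR k * c) ->
  (1 - PI * INR k * c) * RInt (a 0%nat) 0 1 <= RInt (fun x => phi x - x) 0 1.
Proof.
  intros Hcont Hc.
  assert (Hex : ex_RInt (fun x => phi x - x) 0 1).
  { apply (ex_RInt_continuous (V := R_CompleteNormedModule)); intros x _.
    apply (continuous_minus (U := R_UniformSpace) (K := R_AbsRing) (V := R_NormedModule) phi);
      [apply Hcont|apply continuous_id]. }
  destruct (Nat.eq_dec k 0) as [E|E].
  - rewrite E; simpl INR; rewrite Rmult_0_r, Rmult_0_l, Rminus_0_r, Rmult_1_l.
    replace (RInt (a 0%nat) 0 1) with (RInt (fun _ => RInt (a 0%nat) 0 1) 0 1)
      by (rewrite RInt_const; unfold scal; simpl; unfold mult; simpl; ring).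
    apply RInt_le; [lra|apply ex_RInt_const|exact Hex|].
    intros x _; now apply displacement_degree_0.
  - assert (Hk : (0 < k)%nat) by lia.
    pose proof (lt_0_INR k Hk).
    pose proof (is_RInt_trig_minus_correction k (fun j => abar j 1) (fun j => bbar j 1) c Hk) as HI.
    rewrite <- (is_RInt_unique _ _ _ _ HI : _ = (1 - PI * INR k * c) * RInt (a 0%nat) 0 1).
    apply RInt_le; [lra|eexists; exact HI|exact Hex|].
    intros x _; apply displacement_lower_bound; [exact Hk|].
    specialize (Hc x); apply Rmult_le_reg_l in Hc; lra.
Qed.

End Path.

(** * Length *)

Lemma trig_period_mean (k : nat) (A B : nat -> R) : is_RInt (trig k A B) 0 1 (A 0%nat).
Proof.
  rewrite <- (trig1_increment_period k A B 0), Rplus_0_l.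
  apply (is_RInt_derive (trig1 k A B)); intros; [apply is_derive_trig1|apply continuous_trig].
Qed.

Lemma continuous_inv_trig (k : nat) (A B : nat -> R) (x : R) :
  0 < trig k A B x -> continuous (fun y => / trig k A B y) x.
Proof.
  intros H; apply (continuous_comp (trig k A B) Rinv); [apply continuous_trig|].
  apply continuous_Rinv; lra.
Qed.

Lemma ex_RInt_inv_trig (k : nat) (A B : nat -> R) :
  (forall x, 0 <= x <= 1 -> 0 < trig k A B x) -> ex_RInt (fun y => / trig k A B y) 0 1.
Proof.
  intros H; apply (ex_RInt_continuous (V := R_CompleteNormedModule)).
  rewrite Rmin_left, Rmax_right by lra; intros x Hx; now apply continuous_inv_trig, H.
Qed.

Lemma RInt_inv_trig_pos (k : nat) (A B : nat -> R) :
  (forall x, 0 <= x <= 1 -> 0 < trig k A B x) -> 0 < RInt (fun y => / trig k A B y) 0 1.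
Proof.
  intros H; apply RInt_gt_0; [lra| |].
  - intros x Hx; apply Rinv_0_lt_compat, H; lra.
  - intros x Hx; now apply continuous_inv_trig, H.
Qed.

Lemma trig_mean_pos (k : nat) (A B : nat -> R) :
  (forall x, 0 <= x <= 1 -> 0 < trig k A B x) -> 0 < A 0%nat.
Proof.
  intros H; rewrite <- (is_RInt_unique _ _ _ _ (trig_period_mean k A B)).
  apply RInt_gt_0; [lra| |intros; apply continuous_trig].
  intros; apply H; lra.
Qed.

(** Jensen for the reciprocal: its graph lies above the tangent [f] at the mean [m], and the
    integral of [f] is [/ m]. *)
Lemma harmonic_mean_le (k : nat) (A B : nat -> R) :
  (forall x, 0 <= x <= 1 -> 0 < trig k A B x) ->
  / RInt (fun x => / trig k A B x) 0 1 <= A 0%nat.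
Proof.
  intros H; pose proof (trig_mean_pos k A B H) as Hm; set (m := A 0%nat) in *.
  pose (f := fun x => 2 / m - / m ^ 2 * trig k A B x).
  assert (Hf : is_RInt f 0 1 (/ m)).
  { replace (/ m) with (minus (2 / m) (/ m ^ 2 * m))
      by (unfold minus, plus, opp; simpl; field; lra).
    apply (is_RInt_minus (V := R_NormedModule) (fun _ => 2 / m)
             (fun x => / m ^ 2 * trig k A B x)).
    - refine (eq_ind _ (is_RInt (fun _ => 2 / m) 0 1)
               (is_RInt_const (V := R_NormedModule) 0 1 (2 / m)) _ _).
      unfold scal; simpl; unfold mult; simpl; ring.
    - apply (is_RInt_scal (V := R_NormedModule)), trig_period_mean. }
  assert (Hle : / m <= RInt (fun x => / trig k A B x) 0 1).
  { rewrite <- (is_RInt_unique _ _ _ _ Hf).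
    apply RInt_le; [lra|eexists; exact Hf|now apply ex_RInt_inv_trig|].
    intros x Hx; unfold f; specialize (H x ltac:(lra)).
    apply Rminus_le_0.
    replace (/ trig k A B x - (2 / m - / m ^ 2 * trig k A B x))
      with ((trig k A B x - m) ^ 2 * / (trig k A B x * m ^ 2)) by (field; lra).
    apply Rmult_le_pos; [apply pow2_ge_0|left; apply Rinv_0_lt_compat].
    apply Rmult_lt_0_compat; [exact H|now apply pow_lt]. }
  rewrite <- (Rinv_inv m); apply Rinv_le_contravar; [now apply Rinv_0_lt_compat|exact Hle].
Qed.

Lemma trig_coeffs_distance (k : nat) (A B A' B' : nat -> R) (x : R) :
  Rabs (trig k A B x - trig k A' B' x) <=
  sum_f_R0 (fun j => Rabs (A j - A' j) + Rabs (B j - B' j)) k.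
Proof.
  unfold trig, lincomb; rewrite <- minus_sum.
  eapply Rle_trans; [apply Rsum_abs|]; apply sum_Rle; intros j _.
  replace (A j * cosine j x + B j * sine j x - (A' j * cosine j x + B' j * sine j x))
    with ((A j - A' j) * cosine j x + (B j - B' j) * sine j x) by ring.
  eapply Rle_trans; [apply Rabs_triang|]; rewrite !Rabs_mult.
  assert (Hc : Rabs (cosine j x) <= 1) by (apply Rabs_le, COS_bound).
  assert (Hs : Rabs (sine j x) <= 1) by (apply Rabs_le, SIN_bound).
  pose proof (Rabs_pos (A j - A' j)); pose proof (Rabs_pos (B j - B' j)); nra.
Qed.

Lemma continuous_sum_f_R0 (f : nat -> R -> R) (n : nat) (x : R) :
  (forall j, (j <= n)%nat -> continuous (f j) x) ->
  continuous (fun y => sum_f_R0 (fun j => f j y) n) x.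
Proof.
  induction n as [|n IH]; intros H; simpl; [now apply H|].
  apply (continuous_plus (U := R_UniformSpace) (K := R_AbsRing) (V := R_NormedModule)
           (fun y => sum_f_R0 (fun j => f j y) n) (f (S n))).
  - apply IH; intros; apply H; lia.
  - apply H; lia.
Qed.

(** This makes the length density integrable in time. Coefficients near those at [t0] give
    polynomials uniformly near and uniformly bounded below. *)
Lemma continuous_RInt_inv_trig (k : nat) (a b : nat -> R -> R) (t0 : R) :
  (forall j, (j <= k)%nat -> continuous (a j) t0 /\ continuous (b j) t0) ->
  (forall x, 0 <= x <= 1 -> 0 < trig k (fun j => a j t0) (fun j => b j t0) x) ->
  continuous (fun t => RInt (fun x => / trig k (fun j => a j t) (fun j => b j t) x) 0 1) t0.
Proof.
  intros Hc Hpos.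
  pose (h := fun t => trig k (fun j => a j t) (fun j => b j t)).
  change (continuous (fun t => RInt (fun x => / h t x) 0 1) t0).
  destruct (continuity_ab_min (h t0) 0 1) as [xm [Hm Hxm]]; [lra| |].
  { intros x _; apply continuity_pt_filterlim, continuous_trig. }
  assert (Hm0 : 0 < h t0 xm) by now apply Hpos.
  set (m := h t0 xm) in *.
  pose (e := fun t => sum_f_R0 (fun j => Rabs (a j t - a j t0) + Rabs (b j t - b j t0)) k).
  assert (He : continuous e t0).
  { apply (continuous_sum_f_R0 (fun j t => Rabs (a j t - a j t0) + Rabs (b j t - b j t0))).
    intros j Hj; destruct (Hc j Hj) as [Ha Hb].
    apply (continuous_plus (U := R_UniformSpace) (K := R_AbsRing) (V := R_NormedModule)
      (fun t => Rabs (a j t - a j t0)) (fun t => Rabs (b j t - b j t0)));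
    (apply (continuous_comp _ Rabs); [|apply continuous_Rabs]).
    - apply (continuous_minus (U := R_UniformSpace) (K := R_AbsRing) (V := R_NormedModule) (a j));
        [exact Ha|apply continuous_const].
    - apply (continuous_minus (U := R_UniformSpace) (K := R_AbsRing) (V := R_NormedModule) (b j));
        [exact Hb|apply continuous_const]. }
  assert (He0 : e t0 = 0).
  { unfold e; apply sum_eq_R0; intros; rewrite !Rminus_diag, Rabs_R0; ring. }
  apply filterlim_locally; intros eps.
  (* The first bound keeps [h t] above [m / 2], hence [h t x * h t0 x] above [m ^ 2 / 2]; the second
     then makes the reciprocals differ by at most [eps / 2]. *)
  assert (Hd : 0 < Rmin (m / 2) (eps * m ^ 2 / 4)).
  { pose proof (cond_pos eps); apply Rmin_pos; [lra|].
    apply Rmult_lt_0_compat; [|lra]; apply Rmult_lt_0_compat; [lra|now apply pow_lt]. }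
  generalize (proj1 (filterlim_locally e (e t0)) He (mkposreal _ Hd)).
  apply filter_imp; intros t Ht.
  rewrite He0 in Ht; unfold ball in Ht; simpl in Ht; unfold AbsRing_ball, abs, minus, plus, opp in Ht; simpl in Ht.
  rewrite Ropp_0, Rplus_0_r in Ht.
  apply Rle_lt_trans with (1 := Rle_abs _) in Ht.
  pose proof (Rlt_le_trans _ _ _ Ht (Rmin_l _ _)) as Ht1.
  pose proof (Rlt_le_trans _ _ _ Ht (Rmin_r _ _)) as Ht2.
  assert (Hdist : forall x, Rabs (h t x - h t0 x) <= e t) by (intros; apply trig_coeffs_distance).
  assert (Hlow : forall x, 0 <= x <= 1 -> m / 2 < h t x).
  { intros x Hx; pose proof (Hm x Hx); pose proof (Hdist x) as Hdx; apply Rabs_le_between in Hdx; lra. }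
  assert (Ex : ex_RInt (fun x => / h t x) 0 1).
  { apply ex_RInt_inv_trig; intros x Hx; specialize (Hlow x Hx); unfold h in Hlow; lra. }
  assert (Ex0 : ex_RInt (fun x => / h t0 x) 0 1) by now apply ex_RInt_inv_trig.
  unfold ball; simpl; unfold AbsRing_ball, abs, minus, plus, opp; simpl.
  replace (RInt (fun x => / h t x) 0 1 + - RInt (fun x => / h t0 x) 0 1)
    with (RInt (fun x => / h t x - / h t0 x) 0 1)
    by (apply (RInt_minus (V := R_CompleteNormedModule) (fun x => / h t x)); assumption).
  apply Rle_lt_trans with ((1 - 0) * (eps / 2)); [|pose proof (cond_pos eps); lra].
  apply abs_RInt_le_const; [lra| |].
  - now apply (ex_RInt_minus (V := R_CompleteNormedModule) (fun x => / h t x)).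
  - intros x Hx; specialize (Hlow x Hx); specialize (Hm x Hx); specialize (Hdist x).
    replace (/ h t x - / h t0 x) with (- (h t x - h t0 x) * / (h t x * h t0 x)) by (field; lra).
    assert (Hp : m ^ 2 / 2 <= h t x * h t0 x).
    { replace (m ^ 2 / 2) with (m / 2 * m) by field; apply Rmult_le_compat; lra. }
    assert (Hm2 : 0 < m ^ 2) by now apply pow_lt.
    rewrite Rabs_mult, Rabs_Ropp, Rabs_inv, (Rabs_pos_eq (h t x * h t0 x)) by lra.
    apply Rmult_le_reg_r with (h t x * h t0 x); [lra|].
    rewrite Rmult_assoc, Rinv_l by lra.
    apply Rle_trans with (eps / 2 * (m ^ 2 / 2)); [lra|].
    apply Rmult_le_compat_l; [pose proof (cond_pos eps); lra|exact Hp].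
Qed.

Lemma lengthV_le_mean (k : nat) (a b : nat -> R -> R) :
  coeffs_smooth k a b -> positive_ham (ham k a b) ->
  lengthV (ham k a b) <= RInt (a 0%nat) 0 1.
Proof.
  intros Hs Hpos; unfold lengthV; apply RInt_le; [lra| | |].
  - apply (ex_RInt_continuous (V := R_CompleteNormedModule)).
    rewrite Rmin_left, Rmax_right by lra; intros t Ht.
    apply (continuous_comp (fun t => RInt (fun x => / ham k a b t x) 0 1) Rinv).
    + apply (continuous_RInt_inv_trig k a b t).
      * intros j Hj; now apply (coeffs_continuous k).
      * intros x _; now apply Hpos.
    + apply continuous_Rinv, Rgt_not_eq.
      apply (RInt_inv_trig_pos k (fun j => a j t) (fun j => b j t)); intros; now apply Hpos.
  - apply (ex_RInt_continuous (V := R_CompleteNormedModule)); intros t _.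
    apply (coeffs_continuous k a b 0 t Hs); lia.
  - intros t Ht; apply (harmonic_mean_le k (fun j => a j t) (fun j => b j t)).
    intros; apply Hpos; lra.
Qed.

Lemma lengthV_upper_bound (k : nat) (phi : R -> R) (s : R) : Diff1 phi -> 0 < s < 1 ->
  (forall x, 4 * INR k * (phi x - x) <= s) ->
  forall (a b : nat -> R -> R) (Phi : R -> R -> R), Pk_positive_path k a b Phi phi ->
  lengthV (ham k a b) <= / (1 - s) * RInt (fun x => phi x - x) 0 1.
Proof.
  intros [Hphi _] Hs Hle a b Phi path.
  pose proof (lengthV_le_mean k a b (proj1 path) (proj1 (proj2 path))) as HL.
  assert (Hmean : 0 <= RInt (a 0%nat) 0 1).
  { apply RInt_ge_0; [lra| |].
    - apply (ex_RInt_continuous (V := R_CompleteNormedModule)); intros t _.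
      apply (coeffs_continuous k a b 0 t (proj1 path)); lia.
    - intros t Ht; left; apply (trig_mean_pos k (fun j => a j t) (fun j => b j t)).
      intros x _; apply (proj1 (proj2 path)); lra. }
  assert (HV : (1 - s) * RInt (a 0%nat) 0 1 <= RInt (fun x => phi x - x) 0 1).
  { pose proof PI_4; pose proof PI_RGT_0.
    (* The constant [c] is [s / (4 * INR k)]. For [k = 0] the quotient has a default value, which
       the factor [INR k] annihilates. *)
    apply Rle_trans with ((1 - PI * INR k * (s / (4 * INR k))) * RInt (a 0%nat) 0 1).
    - apply Rmult_le_compat_r; [exact Hmean|].
      destruct (Req_dec (INR k) 0) as [E|E]; [rewrite E; lra|].
      replace (PI * INR k * (s / (4 * INR k))) with (PI * s / 4) by (field; exact E); nra.
    - apply (volume_lower_bound k a b Phi phi path).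
      + intros; now apply smooth_continuous.
      + intros x; destruct (Req_dec (INR k) 0) as [E|E]; [rewrite E; lra|].
        replace (INR k * (s / (4 * INR k))) with (s / 4) by (field; exact E).
        specialize (Hle x); lra. }
  apply Rle_trans with (1 := HL).
  apply Rmult_le_reg_l with (1 - s); [lra|].
  rewrite <- Rmult_assoc, Rinv_r, Rmult_1_l by lra; exact HV.
Qed.

Lemma diffn_continuous (f : R -> R) (x : R) : (forall n, diffn n f) -> continuous f x.
Proof.
  intros H; destruct (H 1%nat) as [f' [Hd _]].
  apply (ex_derive_continuous (K := R_AbsRing) (V := R_NormedModule)); eexists; apply Hd.
Qed.

(** * Hamiltonians with one frequency *)

Lemma amplitude_bound (p q c s : R) : c ^ 2 + s ^ 2 = 1 ->
  (p * c + q * s) ^ 2 <= p ^ 2 + q ^ 2.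
Proof.
  intros E.
  assert (H : p ^ 2 + q ^ 2 - (p * c + q * s) ^ 2 = (p * s - q * c) ^ 2).
  { replace (p ^ 2 + q ^ 2) with ((p ^ 2 + q ^ 2) * (c ^ 2 + s ^ 2)) by (rewrite E; ring); ring. }
  pose proof (pow2_ge_0 (p * s - q * c)); lra.
Qed.

Lemma cos2_sin2 (x : R) : cos x ^ 2 + sin x ^ 2 = 1.
Proof. pose proof (sin2_cos2 x) as H; unfold Rsqr in H; lra. Qed.

Lemma one_frequency_pos (a p q x : R) : 0 < a -> p ^ 2 + q ^ 2 < a ^ 2 ->
  0 < a + p * cos x + q * sin x.
Proof.
  intros Ha H; pose proof (amplitude_bound p q _ _ (cos2_sin2 x)).
  nra.
Qed.

(** The antiderivative [G] is a linear term plus a periodic one. The positive denominator inside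
    [atan] avoids the branch jump of the half-angle substitution, so only the linear term
    contributes over a period. *)
Lemma is_RInt_inv_one_frequency (k : nat) (a p q s : R) : (0 < k)%nat ->
  0 < a -> 0 < s -> s ^ 2 = a ^ 2 - p ^ 2 - q ^ 2 ->
  is_RInt (fun x => / (a + p * cos (2 * PI * INR k * x) + q * sin (2 * PI * INR k * x)))
    0 1 (/ s).
Proof.
  intros Hk Ha Hs E; pose proof PI_RGT_0; pose proof (lt_0_INR k Hk).
  assert (Hpos : forall x, 0 < a + p * cos x + q * sin x)
    by (intros; apply one_frequency_pos; [exact Ha|nra]).
  pose (w := 2 * PI * INR k).
  pose (G := fun x => (x - / (PI * INR k) *
    atan ((p * sin (w * x) - q * cos (w * x)) / (a + s + p * cos (w * x) + q * sin (w * x)))) / s).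
  replace (/ s) with (minus (G 1) (G 0)).
  - apply (is_RInt_derive G).
    + intros x _; unfold G; fold w.
      pose proof (Hpos (w * x)) as Hx; pose proof (cos2_sin2 (w * x)) as Hcs.
      auto_derive; [repeat split; lra|].
      set (c := cos (w * x)) in *; set (d := sin (w * x)) in *.
      (* In these rotated coordinates [m ^ 2 + n ^ 2 = p ^ 2 + q ^ 2 = a ^ 2 - s ^ 2], so numerator
         and denominator share the factor [a + s]. *)
      pose (m := p * c + q * d); pose (n := p * d - q * c).
      assert (Hm : 0 < a + m) by (unfold m; lra).
      assert (Hn : n ^ 2 = a ^ 2 - s ^ 2 - m ^ 2).
      { replace (a ^ 2 - s ^ 2) with ((p ^ 2 + q ^ 2) * (c ^ 2 + d ^ 2)) by (rewrite Hcs; lra).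
        unfold n, m; ring. }
      assert (Hden : 0 < (a + s + m) ^ 2 + n ^ 2) by (pose proof (pow2_ge_0 n); nra).
      transitivity ((1 - 2 * (m * (a + s + m) + n ^ 2) / ((a + s + m) ^ 2 + n ^ 2)) / s).
      { unfold w, m, n in *; field; repeat split; lra. }
      rewrite Hn.
      replace (m * (a + s + m) + (a ^ 2 - s ^ 2 - m ^ 2)) with ((a + s) * (m + a - s)) by ring.
      replace ((a + s + m) ^ 2 + (a ^ 2 - s ^ 2 - m ^ 2)) with (2 * (a + s) * (a + m)) by ring.
      replace (a + p * c + q * d) with (a + m) by (unfold m; ring).
      field; lra.
    + intros x _; pose proof (Hpos (w * x)); fold w.
      apply (continuous_comp (fun x => a + p * cos (w * x) + q * sin (w * x)) Rinv);
        [|apply continuous_Rinv; lra].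
      apply (ex_derive_continuous (K := R_AbsRing) (V := R_NormedModule)); auto_derive; auto.
  - unfold minus, plus, opp; simpl; unfold G, w.
    rewrite !Rmult_1_r, !Rmult_0_r, sin_INR_2PI, cos_INR_2PI, sin_0, cos_0; field; lra.
Qed.

Lemma sum_f_R0_ends (f : nat -> R) (k : nat) : (0 < k)%nat ->
  (forall j, (0 < j < k)%nat -> f j = 0) -> sum_f_R0 f k = f 0%nat + f k.
Proof.
  intros Hk; destruct k as [|m]; [lia|]; intros H; simpl; f_equal.
  induction m as [|m IH]; [reflexivity|]; simpl.
  rewrite IH; [|lia|intros j Hj; apply H; lia].
  rewrite (H (S m)) by lia; ring.
Qed.

Definition end_coeff (k : nat) (f g : R -> R) (j : nat) (t : R) : R :=
  if Nat.eqb j 0 then f t else if Nat.eqb j k then g t else 0.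

Lemma ham_one_frequency (k : nat) (a p q : R -> R) (t x : R) : (0 < k)%nat ->
  ham k (end_coeff k a p) (end_coeff k (fun _ => 0) q) t x =
  a t + p t * cos (2 * PI * INR k * x) + q t * sin (2 * PI * INR k * x).
Proof.
  intros Hk; unfold ham; rewrite sum_f_R0_ends; [|exact Hk|].
  - unfold end_coeff; simpl Nat.eqb; cbv iota; rewrite Nat.eqb_refl.
    replace (Nat.eqb k 0) with false by (symmetry; apply Nat.eqb_neq; lia).
    simpl INR; rewrite Rmult_0_r, Rmult_0_l, cos_0, sin_0; ring.
  - intros j Hj; unfold end_coeff.
    replace (Nat.eqb j 0) with false by (symmetry; apply Nat.eqb_neq; lia).
    replace (Nat.eqb j k) with false by (symmetry; apply Nat.eqb_neq; lia); ring.
Qed.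

Lemma diffn_end_coeff (k : nat) (f g : R -> R) (j n : nat) :
  diffn n f -> diffn n g -> diffn n (end_coeff k f g j).
Proof.
  intros Hf Hg; unfold end_coeff.
  destruct (Nat.eqb j 0); [exact Hf|destruct (Nat.eqb j k); [exact Hg|apply diffn_const]].
Qed.

Lemma cos_2_atan (u : R) : cos (2 * atan u) = (1 - u ^ 2) / (1 + u ^ 2).
Proof.
  assert (H : 0 < 1 + u ^ 2) by (pose proof (pow2_ge_0 u); lra).
  rewrite cos_2a_cos, cos_atan.
  pose proof (sqrt_sqrt (1 + u²)) as E; unfold Rsqr in *.
  assert (Hs : 0 < sqrt (1 + u * u)) by (apply sqrt_lt_R0; nra).
  replace (2 * (1 / sqrt (1 + u * u)) * (1 / sqrt (1 + u * u)) - 1)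
    with (2 / (sqrt (1 + u * u) * sqrt (1 + u * u)) - 1) by (field; lra).
  rewrite E by nra; field; nra.
Qed.

Lemma sin_2_atan (u : R) : sin (2 * atan u) = 2 * u / (1 + u ^ 2).
Proof.
  assert (H : 0 < 1 + u ^ 2) by (pose proof (pow2_ge_0 u); lra).
  rewrite sin_2a, cos_atan, sin_atan.
  pose proof (sqrt_sqrt (1 + u²)) as E; unfold Rsqr in *.
  assert (Hs : 0 < sqrt (1 + u * u)) by (apply sqrt_lt_R0; nra).
  replace (2 * (u / sqrt (1 + u * u)) * (1 / sqrt (1 + u * u)))
    with (2 * u / (sqrt (1 + u * u) * sqrt (1 + u * u))) by (field; lra).
  rewrite E by nra; field; nra.
Qed.

(** * Long paths to a translation *)

(* With [r = S / C], [mobius S C z] is the lift of the hyperbolic isometry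
   e^(iz) |-> (e^(iz) + r) / (1 + r e^(iz)) of the circle. *)
Definition mobius (S C z : R) : R := z - 2 * atan (S * sin z / (C + S * cos z)).

Section Mobius.

Variables S C z : R.
Hypothesis C_pos : 0 < C.
Hypothesis C_sqr : C ^ 2 = 1 + S ^ 2.

(** The real part of [C + S e^(iz)] is positive, so the [atan] in [mobius] is the argument of this
    number, whose squared modulus is [N] below; thus [mobius S C z] is a continuous lift. *)
Lemma mobius_denominator_pos : 0 < C + S * cos z.
Proof.
  pose proof (COS_bound z); pose proof (cos2_sin2 z); pose proof (pow2_ge_0 (sin z)).
  assert (H2 : (S * cos z) ^ 2 < C ^ 2) by (rewrite Rpow_mult_distr; nra).
  nra.
Qed.

Let N : R := C ^ 2 + 2 * S * C * cos z + S ^ 2.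

Lemma mobius_norm_pos : 0 < N.
Proof.
  pose proof mobius_denominator_pos; unfold N.
  pose proof (cos2_sin2 z) as Hz.
  replace (C ^ 2 + 2 * S * C * cos z + S ^ 2) with
    ((C + S * cos z) ^ 2 + (S * sin z) ^ 2)
    by (replace (S ^ 2) with (S ^ 2 * (cos z ^ 2 + sin z ^ 2)) by (rewrite Hz; ring); ring).
  pose proof (pow2_ge_0 (S * sin z)); nra.
Qed.

Let u : R := S * sin z / (C + S * cos z).

Let one_plus_u2 : 1 + u ^ 2 = N / (C + S * cos z) ^ 2.
Proof.
  pose proof mobius_denominator_pos; pose proof (cos2_sin2 z) as Hz.
  assert (Hs : sin z ^ 2 = 1 - cos z ^ 2) by lra.
  unfold u, N; field_simplify_eq; [ring [Hs]|lra].
Qed.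

Lemma cos_mobius : cos (mobius S C z) = ((C ^ 2 + S ^ 2) * cos z + 2 * S * C) / N.
Proof.
  pose proof mobius_denominator_pos; pose proof mobius_norm_pos.
  pose proof (cos2_sin2 z) as Hz.
  assert (Hs : sin z ^ 2 = 1 - cos z ^ 2) by lra.
  unfold mobius; rewrite cos_minus; fold u; rewrite cos_2_atan, sin_2_atan, one_plus_u2.
  unfold u; field_simplify_eq; [ring [Hs]|split; lra].
Qed.

Lemma sin_mobius : sin (mobius S C z) = sin z / N.
Proof.
  pose proof mobius_denominator_pos; pose proof mobius_norm_pos.
  pose proof (cos2_sin2 z) as Hz.
  assert (Hs : sin z ^ 2 = 1 - cos z ^ 2) by lra.
  unfold mobius; rewrite sin_minus; fold u; rewrite cos_2_atan, sin_2_atan, one_plus_u2.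
  unfold u; field_simplify_eq; [ring [Hs C_sqr]|split; lra].
Qed.

End Mobius.

(** The path is a rotation by [T], a hyperbolic map and the same rotation again. With [S] the
    tangent and [C] the secant of a height, [g] is the speed of the height. The velocity is written
    at the image under [mobius], where it has a single frequency. *)
Lemma is_derive_mobius_path (S C T : R -> R) (y0 t v g : R) :
  0 < C t -> C t ^ 2 = 1 + S t ^ 2 ->
  is_derive S t (g * C t ^ 2) -> is_derive C t (g * S t * C t) -> is_derive T t v ->
  is_derive (fun s => mobius (S s) (C s) (y0 + T s) + T s) t
    (2 * v * C t ^ 2 - 2 * v * S t * C t * cos (mobius (S t) (C t) (y0 + T t))
     - 2 * g * C t * sin (mobius (S t) (C t) (y0 + T t))).
Proof.
  intros HC HC2 HdS HdC HdT.
  rewrite cos_mobius, sin_mobius by assumption.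
  pose proof (mobius_denominator_pos _ _ (y0 + T t) HC HC2) as HD.
  pose proof (mobius_norm_pos _ _ (y0 + T t) HC HC2) as HN.
  unfold mobius.
  auto_derive.
  { repeat split; try (now eexists; eassumption); lra. }
  replace (Derive (fun x : R => S x) t) with (g * C t ^ 2)
    by (symmetry; apply is_derive_unique, HdS).
  replace (Derive (fun x : R => C x) t) with (g * S t * C t)
    by (symmetry; apply is_derive_unique, HdC).
  replace (Derive (fun x : R => T x) t) with v by (symmetry; apply is_derive_unique, HdT).
  set (c := cos (y0 + T t)) in *; set (s := sin (y0 + T t)) in *.
  assert (Hs : s ^ 2 = 1 - c ^ 2) by (pose proof (cos2_sin2 (y0 + T t)); unfold s, c; lra).
  set (X := S t) in *; set (Y := C t) in *.
  assert (HN' : (Y + X * c) ^ 2 + (X * s) ^ 2 = Y ^ 2 + 2 * X * Y * c + X ^ 2) by ring [Hs].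
  transitivity (2 * v - 2 * ((g * Y ^ 2 * s + X * c * v) * (Y + X * c) -
      X * s * (g * X * Y + g * Y ^ 2 * c - X * s * v)) / ((Y + X * c) ^ 2 + (X * s) ^ 2)).
  { field; split; nra. }
  rewrite HN'; field_simplify_eq; [|lra].
  ring [Hs HC2].
Qed.

Lemma diffn_pow2 (n : nat) (f : R -> R) : diffn n f -> diffn n (fun x => f x ^ 2).
Proof.
  intros H; apply diffn_ext with (fun x => f x * f x); [intros; ring|now apply diffn_mult].
Qed.

Lemma sqrt_sum_pow2_le (x y : R) : 0 <= x -> 0 <= y -> sqrt (x ^ 2 + y ^ 2) <= x + y.
Proof.
  intros Hx Hy; rewrite <- (sqrt_pow2 (x + y)) by lra; apply sqrt_le_1_alt; nra.
Qed.

Section LongPath.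

Variables (k : nat) (del L : R).
Hypothesis k_pos : (0 < k)%nat.
Hypothesis del_pos : 0 < del.
Hypothesis L_pos : 0 < L.

(* The curve has height [atan (bump t)] and time coordinate [turn t] in the
   conformal picture of anti-de Sitter space: it is timelike because
   [angle' < speed], and its length density is [hyp * sqrt (speed ^ 2 - angle' ^ 2)]. *)
Definition bump (t : R) : R := 4 * L * t * (1 - t).
Definition bump' (t : R) : R := 4 * L * (1 - 2 * t).
Definition hyp (t : R) : R := sqrt (1 + bump t ^ 2).
Definition angle' (t : R) : R := bump' t / (1 + bump t ^ 2).
Definition speed0 (t : R) : R := sqrt (angle' t ^ 2 + (PI * del) ^ 2).
(** Chosen so that [turn 1] is exactly [PI * (1 + del)], whatever [L] is. *)
Definition extra : R := PI * (1 + del) - RInt speed0 0 1.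
Definition speed (t : R) : R := speed0 t + extra.
Definition turn (t : R) : R := RInt speed0 0 t + extra * t.

Let one_bump2_pos (t : R) : 0 < 1 + bump t ^ 2.
Proof. pose proof (pow2_ge_0 (bump t)); lra. Qed.

Let pidel_pos : 0 < PI * del.
Proof. apply Rmult_lt_0_compat; [apply PI_RGT_0|exact del_pos]. Qed.

Let radicand_pos (t : R) : 0 < angle' t ^ 2 + (PI * del) ^ 2.
Proof. pose proof (pow2_ge_0 (angle' t)); nra. Qed.

Lemma diffn_bump (n : nat) : diffn n bump.
Proof.
  unfold bump; repeat apply diffn_mult; try apply diffn_const; try apply diffn_id.
  apply diffn_plus; [apply diffn_const|apply diffn_opp, diffn_id].
Qed.

Lemma diffn_hyp (n : nat) : diffn n hyp.
Proof.
  apply diffn_sqrt; [exact one_bump2_pos|].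
  apply diffn_plus; [apply diffn_const|apply diffn_pow2, diffn_bump].
Qed.

Lemma diffn_angle' (n : nat) : diffn n angle'.
Proof.
  unfold angle', Rdiv; apply diffn_mult.
  - unfold bump'; apply diffn_mult; [apply diffn_const|].
    apply diffn_plus; [apply diffn_const|apply diffn_opp, diffn_mult; [apply diffn_const|apply diffn_id]].
  - apply diffn_inv; [intros x; pose proof (one_bump2_pos x); lra|].
    apply diffn_plus; [apply diffn_const|apply diffn_pow2, diffn_bump].
Qed.

Lemma diffn_speed0 (n : nat) : diffn n speed0.
Proof.
  apply diffn_sqrt; [exact radicand_pos|].
  apply diffn_plus; [apply diffn_pow2, diffn_angle'|apply diffn_const].
Qed.

Lemma diffn_speed (n : nat) : diffn n speed.
Proof. apply diffn_plus; [apply diffn_speed0|apply diffn_const]. Qed.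

Lemma is_derive_RInt_speed0 (t : R) : is_derive (RInt speed0 0) t (speed0 t).
Proof.
  apply is_derive_RInt_continuous; intros; apply diffn_continuous, diffn_speed0.
Qed.

Lemma is_derive_turn (t : R) : is_derive turn t (speed t).
Proof.
  apply (is_derive_plus (K := R_AbsRing) (V := R_NormedModule) (RInt speed0 0) (fun s => extra * s)).
  - apply is_derive_RInt_speed0.
  - auto_derive; auto; ring.
Qed.

Lemma diffn_turn (n : nat) : diffn n turn.
Proof.
  destruct n as [|n]; [exact I|].
  exists speed; split; [apply is_derive_turn|apply diffn_speed].
Qed.

Lemma is_derive_bump (t : R) : is_derive bump t (bump' t).
Proof. unfold bump, bump'; auto_derive; auto; ring. Qed.

Lemma hyp_pos (t : R) : 0 < hyp t.
Proof. apply sqrt_lt_R0, one_bump2_pos. Qed.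

Lemma hyp_sqr (t : R) : hyp t ^ 2 = 1 + bump t ^ 2.
Proof. unfold hyp; rewrite pow2_sqrt; [reflexivity|left; apply one_bump2_pos]. Qed.

Lemma bump'_eq (t : R) : bump' t = angle' t * hyp t ^ 2.
Proof. rewrite hyp_sqr; unfold angle'; field; pose proof (one_bump2_pos t); lra. Qed.

Lemma is_derive_hyp (t : R) : is_derive hyp t (angle' t * bump t * hyp t).
Proof.
  replace (angle' t * bump t * hyp t) with ((2 * bump t * bump' t) / (2 * hyp t)).
  - apply (is_derive_sqrt (fun s => 1 + bump s ^ 2) t); [|apply one_bump2_pos].
    unfold bump, bump'; auto_derive; auto; ring.
  - rewrite bump'_eq; field; pose proof (hyp_pos t); lra.
Qed.

Lemma is_derive_atan_bump (t : R) : is_derive (fun s => atan (bump s)) t (angle' t).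
Proof.
  replace (angle' t) with (bump' t * / (1 + (bump t)²))
    by (unfold angle', Rdiv, Rsqr; do 2 f_equal; ring).
  apply (is_derive_comp atan bump); [apply is_derive_atan|apply is_derive_bump].
Qed.

(* A curve of slope close to 1 reaches height [atan L < PI / 2] and returns to
   height 0 within time [PI]; the extra time [PI * del] is spent uniformly. *)
Lemma RInt_speed0_le : RInt speed0 0 1 <= PI * (1 + del).
Proof.
  assert (Ha : forall x, atan x <= PI / 2) by (intros x; pose proof (atan_bound x); lra).
  assert (Hb : forall t, 0 <= t <= 1 / 2 -> 0 <= angle' t).
  { intros t Ht; apply Rmult_le_pos; [unfold bump'; nra|].
    left; apply Rinv_0_lt_compat, one_bump2_pos. }
  assert (Hb' : forall t, 1 / 2 <= t <= 1 -> 0 <= - angle' t).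
  { intros t Ht; unfold angle', Rdiv; rewrite <- Ropp_mult_distr_l_reverse.
    apply Rmult_le_pos; [unfold bump'; nra|].
    left; apply Rinv_0_lt_compat, one_bump2_pos. }
  (* On each half [angle'] has a fixed sign, so its absolute value integrates to the peak height
     [atan (bump (1 / 2))], and [speed0] is at most this absolute value plus [PI * del]. *)
  assert (H1 : RInt speed0 0 (1 / 2) <= atan (bump (1 / 2)) + PI * del * (1 / 2)).
  { pose (F := fun t => atan (bump t) + PI * del * t - RInt speed0 0 t).
    assert (HF : F 0 <= F (1 / 2)).
    { apply nonneg_derive_le with (fun t => angle' t + PI * del - speed0 t); [lra| |].
      - intros t _.
        apply (is_derive_minus (K := R_AbsRing) (V := R_NormedModule)
          (fun t => atan (bump t) + PI * del * t)); [|apply is_derive_RInt_speed0].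
        apply (is_derive_plus (K := R_AbsRing) (V := R_NormedModule) (fun t => atan (bump t)));
          [apply is_derive_atan_bump|auto_derive; auto; ring].
      - intros t Ht; unfold speed0.
        pose proof (sqrt_sum_pow2_le (angle' t) (PI * del) (Hb t Ht)); lra. }
    unfold F in HF; rewrite RInt_point in HF; unfold zero in HF; simpl in HF.
    unfold bump at 1 in HF; replace (4 * L * 0 * (1 - 0)) with 0 in HF by ring.
    rewrite atan_0 in HF; lra. }
  assert (H2 : RInt speed0 0 1 - RInt speed0 0 (1 / 2) <= atan (bump (1 / 2)) + PI * del * (1 / 2)).
  { pose (F := fun t => - atan (bump t) + PI * del * t - RInt speed0 0 t).
    assert (HF : F (1 / 2) <= F 1).
    { apply nonneg_derive_le with (fun t => - angle' t + PI * del - speed0 t); [lra| |].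
      - intros t _.
        apply (is_derive_minus (K := R_AbsRing) (V := R_NormedModule)
          (fun t => - atan (bump t) + PI * del * t)); [|apply is_derive_RInt_speed0].
        apply (is_derive_plus (K := R_AbsRing) (V := R_NormedModule) (fun t => - atan (bump t)));
          [|auto_derive; auto; ring].
        apply (is_derive_opp (K := R_AbsRing) (V := R_NormedModule) (fun t => atan (bump t))).
        apply is_derive_atan_bump.
      - intros t Ht; unfold speed0.
        pose proof (sqrt_sum_pow2_le (- angle' t) (PI * del) (Hb' t Ht)) as H.
        replace ((- angle' t) ^ 2) with (angle' t ^ 2) in H by ring; lra. }
    unfold F in HF; unfold bump at 2 in HF; replace (4 * L * 1 * (1 - 1)) with 0 in HF by ring.
    rewrite atan_0 in HF; lra. }
  pose proof (Ha (bump (1 / 2))); lra.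
Qed.

Lemma extra_nonneg : 0 <= extra.
Proof. unfold extra; pose proof RInt_speed0_le; lra. Qed.

Lemma speed_pos (t : R) : 0 < speed t.
Proof.
  pose proof extra_nonneg; pose proof (sqrt_lt_R0 _ (radicand_pos t)).
  unfold speed, speed0; lra.
Qed.

Lemma speed_gap (t : R) : (PI * del) ^ 2 <= speed t ^ 2 - angle' t ^ 2.
Proof.
  assert (H0 : speed0 t ^ 2 = angle' t ^ 2 + (PI * del) ^ 2)
    by (unfold speed0; apply pow2_sqrt; left; apply radicand_pos).
  assert (H1 : 0 <= speed0 t) by apply sqrt_pos.
  pose proof extra_nonneg; unfold speed; nra.
Qed.

Definition scale : R := / (2 * PI * INR k).

Lemma scale_pos : 0 < scale.
Proof.
  apply Rinv_0_lt_compat; pose proof PI_RGT_0; pose proof (lt_0_INR k k_pos); nra.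
Qed.

(** The coefficients come from [is_derive_mobius_path] with [v = speed] and [g = angle']. The flow
    point is the image under [mobius] plus [turn t], so the cosine and sine parts are rotated by
    [turn t]. *)
Definition mean_coeff (t : R) : R := scale * (2 * speed t * hyp t ^ 2).
Definition cos_coeff (t : R) : R :=
  scale * (-2 * speed t * bump t * hyp t * cos (turn t) + 2 * angle' t * hyp t * sin (turn t)).
Definition sin_coeff (t : R) : R :=
  scale * (-2 * speed t * bump t * hyp t * sin (turn t) + -2 * angle' t * hyp t * cos (turn t)).

Definition long_a : nat -> R -> R := end_coeff k mean_coeff cos_coeff.
Definition long_b : nat -> R -> R := end_coeff k (fun _ => 0) sin_coeff.
Definition long_flow (t x : R) : R :=
  scale * (mobius (bump t) (hyp t) (2 * PI * INR k * x + turn t) + turn t).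

Lemma diffn_mean_coeff (n : nat) : diffn n mean_coeff.
Proof.
  repeat (apply diffn_mult || apply diffn_const || apply diffn_speed || apply diffn_pow2
          || apply diffn_hyp).
Qed.

Lemma diffn_cos_coeff (n : nat) : diffn n cos_coeff.
Proof.
  destruct (diffn_cos_sin n turn (diffn_turn n)).
  apply diffn_mult; [apply diffn_const|apply diffn_plus];
  repeat (assumption || apply diffn_const || apply diffn_speed || apply diffn_hyp
          || apply diffn_bump || apply diffn_angle' || apply diffn_mult).
Qed.

Lemma diffn_sin_coeff (n : nat) : diffn n sin_coeff.
Proof.
  destruct (diffn_cos_sin n turn (diffn_turn n)).
  apply diffn_mult; [apply diffn_const|apply diffn_plus];
  repeat (assumption || apply diffn_const || apply diffn_speed || apply diffn_hyp
          || apply diffn_bump || apply diffn_angle' || apply diffn_mult).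
Qed.

Lemma coeffs_smooth_long : coeffs_smooth k long_a long_b.
Proof.
  intros j _; split; apply diffn_smooth; intros n; apply diffn_end_coeff.
  - apply diffn_mean_coeff.
  - apply diffn_cos_coeff.
  - apply diffn_const.
  - apply diffn_sin_coeff.
Qed.

Definition harmonic_mean (t : R) : R :=
  2 * scale * hyp t * sqrt (speed t ^ 2 - angle' t ^ 2).

Let gap_pos (t : R) : 0 < speed t ^ 2 - angle' t ^ 2.
Proof. pose proof (speed_gap t); nra. Qed.

Lemma harmonic_mean_pos (t : R) : 0 < harmonic_mean t.
Proof.
  pose proof scale_pos; pose proof (hyp_pos t); pose proof (sqrt_lt_R0 _ (gap_pos t)).
  unfold harmonic_mean; repeat apply Rmult_lt_0_compat; lra.
Qed.

(** The rotation by [turn t] preserves the sum of the last two squares, and [hyp ^ 2 - bump ^ 2 = 1]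
    leaves the Lorentzian norm of the velocity. *)
Lemma harmonic_mean_sqr (t : R) :
  harmonic_mean t ^ 2 = mean_coeff t ^ 2 - cos_coeff t ^ 2 - sin_coeff t ^ 2.
Proof.
  unfold harmonic_mean; rewrite !Rpow_mult_distr, pow2_sqrt by (left; apply gap_pos).
  unfold mean_coeff, cos_coeff, sin_coeff.
  assert (Hs : sin (turn t) ^ 2 = 1 - cos (turn t) ^ 2) by (pose proof (cos2_sin2 (turn t)); lra).
  pose proof (hyp_sqr t) as Hh.
  ring [Hs Hh].
Qed.

Lemma mean_coeff_pos (t : R) : 0 < mean_coeff t.
Proof.
  pose proof scale_pos; pose proof (pow_lt _ 2 (hyp_pos t)); pose proof (speed_pos t).
  unfold mean_coeff; apply Rmult_lt_0_compat; [|apply Rmult_lt_0_compat]; lra.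
Qed.

Lemma positive_ham_long : positive_ham (ham k long_a long_b).
Proof.
  intros t x _; unfold long_a, long_b; rewrite ham_one_frequency by exact k_pos.
  apply one_frequency_pos; [apply mean_coeff_pos|].
  pose proof (harmonic_mean_sqr t); pose proof (pow_lt _ 2 (harmonic_mean_pos t)); lra.
Qed.

Let scale_cancel (y : R) : 2 * PI * INR k * (scale * y) = y.
Proof.
  unfold scale; pose proof PI_RGT_0; pose proof (lt_0_INR k k_pos); field; lra.
Qed.

Lemma mobius_0_1 (z : R) : mobius 0 1 z = z.
Proof.
  unfold mobius; replace (0 * sin z / (1 + 0 * cos z)) with 0 by field; rewrite atan_0; ring.
Qed.

Lemma generates_long : generates (ham k long_a long_b) long_flow.
Proof.
  split.
  - intros x; unfold long_flow.
    assert (Hb : bump 0 = 0) by (unfold bump; ring).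
    assert (Hh : hyp 0 = 1) by (unfold hyp; rewrite Hb; rewrite pow_ne_zero, Rplus_0_r by lia; apply sqrt_1).
    assert (Ht : turn 0 = 0) by (unfold turn; rewrite RInt_point; unfold zero; simpl; ring).
    rewrite Hb, Hh, Ht, mobius_0_1, !Rplus_0_r; unfold scale.
    pose proof PI_RGT_0; pose proof (lt_0_INR k k_pos); field; lra.
  - intros x t _; unfold long_a, long_b; rewrite ham_one_frequency by exact k_pos.
    unfold long_flow at 2 3; rewrite !scale_cancel.
    set (z := 2 * PI * INR k * x + turn t).
    replace (_ + _ + _) with (scale * (2 * speed t * hyp t ^ 2
      - 2 * speed t * bump t * hyp t * cos (mobius (bump t) (hyp t) z)
      - 2 * angle' t * hyp t * sin (mobius (bump t) (hyp t) z))).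
    + apply (is_derive_scal (fun s => mobius (bump s) (hyp s) (2 * PI * INR k * x + turn s) + turn s)).
      apply is_derive_mobius_path.
      * apply hyp_pos.
      * apply hyp_sqr.
      * rewrite <- bump'_eq; apply is_derive_bump.
      * apply is_derive_hyp.
      * apply is_derive_turn.
    + unfold mean_coeff, cos_coeff, sin_coeff.
      rewrite cos_plus, sin_plus.
      assert (Hs : sin (turn t) ^ 2 = 1 - cos (turn t) ^ 2) by (pose proof (cos2_sin2 (turn t)); lra).
      ring [Hs].
Qed.

(** The hyperbolic part is trivial again at time 1. The rotation acts both inside and outside
    [mobius], so the total angle is [2 * PI * (1 + del)]. *)
Lemma long_flow_1 (x : R) : long_flow 1 x = x + (1 + del) / INR k.
Proof.
  unfold long_flow.
  assert (Hb : bump 1 = 0) by (unfold bump; ring).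
  assert (Hh : hyp 1 = 1) by (unfold hyp; rewrite Hb; rewrite pow_ne_zero, Rplus_0_r by lia; apply sqrt_1).
  assert (Ht : turn 1 = PI * (1 + del)) by (unfold turn, extra; ring).
  rewrite Hb, Hh, Ht, mobius_0_1; unfold scale.
  pose proof PI_RGT_0; pose proof (lt_0_INR k k_pos); field; lra.
Qed.

(** The density is at least [2 * scale * (PI * del) * bump t], by [bump <= hyp] and [speed_gap], and
    [bump] has integral [2 * L / 3]. *)
Lemma lengthV_long : 2 * del * L / (3 * INR k) <= lengthV (ham k long_a long_b).
Proof.
  pose proof PI_RGT_0; pose proof (lt_0_INR k k_pos).
  unfold lengthV.
  rewrite (RInt_ext _ harmonic_mean).
  2:{ intros t _; rewrite <- (Rinv_inv (harmonic_mean t)); f_equal.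
      apply is_RInt_unique.
      apply is_RInt_ext with (fun x => / (mean_coeff t + cos_coeff t * cos (2 * PI * INR k * x)
                                          + sin_coeff t * sin (2 * PI * INR k * x))).
      - intros x _; unfold long_a, long_b; now rewrite ham_one_frequency.
      - apply is_RInt_inv_one_frequency;
          [exact k_pos|apply mean_coeff_pos|apply harmonic_mean_pos|apply harmonic_mean_sqr]. }
  pose (F := fun t => 2 * scale * (PI * del) * (4 * L * (t ^ 2 / 2 - t ^ 3 / 3))).
  assert (HF : is_RInt (fun t => 2 * scale * (PI * del) * bump t) 0 1 (minus (F 1) (F 0))).
  { apply (is_RInt_derive F).
    - intros t _; unfold F, bump; auto_derive; auto; field.
    - intros t _; apply diffn_continuous; intros n.
      apply diffn_mult; [apply diffn_const|apply diffn_bump]. }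
  replace (2 * del * L / (3 * INR k)) with (RInt (fun t => 2 * scale * (PI * del) * bump t) 0 1).
  - apply RInt_le; [lra|eexists; exact HF| |].
    + apply (ex_RInt_continuous (V := R_CompleteNormedModule)); intros t _.
      apply diffn_continuous; intros n; unfold harmonic_mean.
      apply diffn_mult; [apply diffn_mult; [apply diffn_const|apply diffn_hyp]|].
      apply diffn_sqrt; [exact gap_pos|].
      apply diffn_plus; [apply diffn_pow2, diffn_speed|apply diffn_opp, diffn_pow2, diffn_angle'].
    + intros t Ht; unfold harmonic_mean; pose proof scale_pos.
      assert (Hb : 0 <= bump t) by (unfold bump; apply Rmult_le_pos; [apply Rmult_le_pos|]; lra).
      assert (Hh : bump t <= hyp t).
      { unfold hyp; rewrite <- (sqrt_pow2 (bump t)) at 1 by exact Hb; apply sqrt_le_1_alt; lra. }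
      assert (Hg : PI * del <= sqrt (speed t ^ 2 - angle' t ^ 2)).
      { rewrite <- (sqrt_pow2 (PI * del)) by lra; apply sqrt_le_1_alt, speed_gap. }
      rewrite !Rmult_assoc; do 2 (apply Rmult_le_compat_l; [lra|]).
      rewrite <- Rmult_assoc, Rmult_comm; apply Rmult_le_compat; lra.
  - rewrite (is_RInt_unique _ _ _ _ HF); unfold minus, plus, opp; simpl; unfold F, scale.
    field; lra.
Qed.

End LongPath.

(** * A translation below [phi] and the final statement *)

Lemma Diff1_translation (d : R) : Diff1 (fun x => x + d).
Proof.
  assert (H : forall e, smooth (fun x => x + e)).
  { intros e; apply diffn_smooth; intros n; apply diffn_plus; [apply diffn_id|apply diffn_const]. }
  split; [apply H|split].
  - exists (fun x => x + - d); split; [apply H|split; intros; ring].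
  - intros; ring.
Qed.

Lemma equivariant_IZR (phi : R -> R) : (forall x, phi (x + 1) = phi x + 1) ->
  forall (z : Z) (x : R), phi (x + IZR z) = phi x + IZR z.
Proof.
  intros H; induction z as [|z IH|z IH] using Z.peano_ind; intros x.
  - now rewrite !Rplus_0_r.
  - rewrite succ_IZR, <- !Rplus_assoc, H, IH; reflexivity.
  - rewrite <- Z.sub_1_r, minus_IZR.
    pose proof (H (x + (IZR z - 1))) as E.
    replace (x + (IZR z - 1) + 1) with (x + IZR z) in E by ring; rewrite IH in E; lra.
Qed.

(** The displacement is continuous and 1-periodic; its minimum turns the pointwise strict inequality
    in (ii) into a uniform gap. *)
Lemma displacement_min (phi : R -> R) : Diff1 phi ->
  exists x0, forall x, phi x0 - x0 <= phi x - x.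
Proof.
  intros [Hs [_ Hp]].
  destruct (continuity_ab_min (fun x => phi x - x) 0 1) as [x0 [Hx0 _]]; [lra| |].
  - intros x _; apply continuity_pt_filterlim.
    apply (continuous_minus (U := R_UniformSpace) (K := R_AbsRing) (V := R_NormedModule) phi);
      [apply (smooth_continuous phi x Hs)|apply continuous_id].
  - exists x0; intros x.
    pose proof (equivariant_IZR phi Hp (Int_part x) (frac_part x)) as E.
    replace (frac_part x + IZR (Int_part x)) with x in E by (unfold frac_part; ring).
    destruct (base_fp x) as [H1 H2].
    specialize (Hx0 (frac_part x) ltac:(lra)); unfold frac_part in *; lra.
Qed.

Lemma arbitrarily_long_paths (k : nat) (phi : R -> R) : Diff1 phi ->
  (forall x, INR k * (phi x - x) > 1) ->
  exists psi : R -> R, Diff1 psi /\ (forall x, x < psi x < phi x) /\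
    forall M : R, exists (a b : nat -> R -> R) (Phi : R -> R -> R),
      Pk_positive_path k a b Phi psi /\ lengthV (ham k a b) > M.
Proof.
  intros Hphi Hgt.
  assert (Hk : (0 < k)%nat).
  { destruct k; [|lia]; specialize (Hgt 0); simpl in Hgt; lra. }
  pose proof (lt_0_INR k Hk) as HK.
  destruct (displacement_min phi Hphi) as [x0 Hx0].
  (* This puts [1 + del] halfway between 1 and the least value of [INR k * (phi x - x)]. *)
  pose (del := (INR k * (phi x0 - x0) - 1) / 2).
  assert (Hdel : 0 < del) by (specialize (Hgt x0); unfold del; lra).
  exists (fun x => x + (1 + del) / INR k); split; [apply Diff1_translation|split].
  - intros x; split.
    + assert (0 < (1 + del) / INR k) by (apply Rdiv_lt_0_compat; lra); lra.
    + apply Rlt_le_trans with (x + (phi x0 - x0)); [|specialize (Hx0 x); lra].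
      apply Rplus_lt_compat_l, Rmult_lt_reg_l with (INR k); [exact HK|].
      replace (INR k * ((1 + del) / INR k)) with (1 + del) by (field; lra).
      specialize (Hgt x0); unfold del; lra.
  - intros M.
    (* With this height the lower bound of [lengthV_long] is exactly [Rabs M + 1]. *)
    pose (L := (Rabs M + 1) * (3 * INR k) / (2 * del)).
    pose proof (Rabs_pos M).
    assert (HL : 0 < L) by (apply Rdiv_lt_0_compat; nra).
    exists (long_a k del L), (long_b k del L), (long_flow k del L); split.
    + split; [now apply coeffs_smooth_long|split; [now apply positive_ham_long|split]].
      * now apply generates_long.
      * intros x; now apply long_flow_1.
    + apply Rlt_le_trans with (2 := lengthV_long k del L Hk Hdel HL).
      replace (2 * del * L / (3 * INR k)) with (Rabs M + 1) by (unfold L; field; lra).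
      pose proof (Rle_abs M); lra.
Qed.

Theorem theorem6 (k : nat) (phi : R -> R) (Hphi : Diff1 phi) :
  (forall s : R, 0 < s < 1 ->
     (forall x, 4 * INR k * (phi x - x) <= s) ->
     forall (a b : nat -> R -> R) (Phi : R -> R -> R),
       Pk_positive_path k a b Phi phi ->
       lengthV (ham k a b) <= / (1 - s) * RInt (fun x => phi x - x) 0 1)
  /\
  ((forall x, INR k * (phi x - x) > 1) ->
     exists psi : R -> R, Diff1 psi /\ (forall x, x < psi x < phi x) /\
       forall M : R, exists (a b : nat -> R -> R) (Phi : R -> R -> R),
         Pk_positive_path k a b Phi psi /\ lengthV (ham k a b) > M).
Proof.
  split.
  - intros s Hs Hle; now apply lengthV_upper_bound.
  - now apply arbitrarily_long_paths.
Qed.
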